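(* Let $\mathcal{F}$ be a family of extrapolation pairs on $\mathbb{R}^n$. Let $\Phi$ be a Young function or $\Phi(t)=t$, and let $A$ and $B$ be Young functions such that $A^{-1}(t)B^{-1}(t)\lesssim\Phi^{-1}(t)$. Suppose that $u$ and $v$ are weights on $\mathbb{R}^n$, and $\mathbb{X}_v$ and $\mathbb{X}_{M_Av}$ are Banach function spaces over $(\mathbb{R}^n,v\,dx)$ and over $(\mathbb{R}^n,M_Av\,dx)$ respectively. Assume that for some $p_0\in(0,\infty)$ there is a constant $C$ such that for every weight $w_0$, $$\|f\|_{L^{p_0}(w_0)}\le C\,\|g\|_{L^{p_0}(M_\Phi w_0)},\qquad (f,g)\in\mathcal{F}.$$ (i) If $\mathbb{Y}_v=\mathbb{X}_v^{\frac1{p_0}}$ is a Banach function space such that, for some constant $C$, $$\|M'_{B,v}f\|_{\mathbb{Y}_v'}\le C\,\|f\|_{\mathbb{Y}_v'}\qquad\text{for all measurable } f,$$ then there is a constant $C$ such that $$\|fu\|_{\mathbb{X}_v}\le C\,\big\|g\,M_A(u^{p_0})^{\frac1{p_0}}\big\|_{\mathbb{X}_v},\qquad (f,g)\in\mathcal{F}.$$ (ii) If both $\mathbb{Y}_v=\mathbb{X}_v^{\frac1{p_0}}$ and $\mathbb{Y}_{M_Av}=\mathbb{X}_{M_Av}^{\frac1{p_0}}$ are Banach function spaces such that, for some constant $C$, $$\|M'_{B,u^{p_0}}f\|_{\mathbb{Y}_{M_Av}'}\le C\,\|f\|_{\mathbb{Y}_v'}\qquad\text{for all measurable } f,$$ then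 there is a constant $C$ such that $$\|fu\|_{\mathbb{X}_v}\le C\,\|gu\|_{\mathbb{X}_{M_Av}},\qquad (f,g)\in\mathcal{F}.$$
   Context: A weight on $\mathbb{R}^n$ is a measurable $w$ with $0<w<\infty$ a.e.; $w(E)=\int_E w\,dx$; $\|f\|_{L^p(w)}=(\int|f|^p w\,dx)^{1/p}$. A Young function is a continuous, convex, strictly increasing $\Phi:[0,\infty)\to[0,\infty)$ with $\Phi(t)/t\to0$ as $t\to0^+$ and $\Phi(t)/t\to\infty$ as $t\to\infty$; $\Phi^{-1}$ is its inverse. $A^{-1}(t)B^{-1}(t)\lesssim\Phi^{-1}(t)$ means there is $c>0$ with $A^{-1}(t)B^{-1}(t)\le c\,\Phi^{-1}(t)$ for all $t>0$. For a cube $Q$, $\|f\|_{\Phi,Q}=\inf\{\lambda>0:\frac1{|Q|}\int_Q\Phi(|f|/\lambda)\,dx\le1\}$ and $M_\Phi f(x)=\sup_{Q\ni x}\|f\|_{\Phi,Q}$; for $\Phi(t)=t$ this is the Hardy–Littlewood maximal operator. For a weight $\omega$, $M'_{B,\omega}f(x)=M_B(f\omega)(x)/\omega(x)$ if $\omega(x)\ne0$ and $0$ otherwise. A family of extrapolation pairs is a collection of pairs $(f,g)$ of nonnegative measurable functions on $\mathbb{R}^n$. Let $\mathbb{M}$ be the set of (classes of) measurable functions on $\mathbb{R}^n$. For a weight $\omega$, a Banach function space (BFS) over $(\mathbb{R}^n,\omega\,dx)$ is $\mathbb{X}_\omega=\{f\in\mathbb{M}:\|f\|_{\mathbb{X}_\omega}<\infty\}$,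 where $\|\cdot\|=\|\cdot\|_{\mathbb{X}_\omega}:\mathbb{M}\to[0,\infty]$ satisfies: (1) $\|f\|=\||f|\|$, and $\|f\|=0$ iff $f=0$ a.e.; (2) $\|f+g\|\le\|f\|+\|g\|$; (3) $\|\lambda f\|=|\lambda|\|f\|$; (4) $|f|\le|g|$ a.e. implies $\|f\|\le\|g\|$; (5) $|f_j|\uparrow|f|$ a.e. implies $\|f_j\|\uparrow\|f\|$; (6) if $\omega(E)<\infty$ then $\|\mathbf{1}_E\|<\infty$ and $\int_E|f|\,\omega\,dx\le C_E\|f\|$. The associate space $\mathbb{X}_\omega'$ has norm $\|f\|_{\mathbb{X}_\omega'}=\sup\{\int|fg|\,\omega\,dx:\|g\|_{\mathbb{X}_\omega}\le1\}$. For $0<p<\infty$, $\mathbb{X}_\omega^p$ is defined by $\|f\|_{\mathbb{X}_\omega^p}:=\||f|^p\|_{\mathbb{X}_\omega}^{1/p}$. Functions not in a space have norm $+\infty$. *)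

(* Defs.v *)
From HB Require Import structures.
From mathcomp Require Import all_boot all_order all_algebra.
From mathcomp Require Import all_classical all_reals all_analysis.
From mathcomp Require Import measurable_realfun.

Set Implicit Arguments.
Unset Strict Implicit.
Unset Printing Implicit Defensive.

Import Order.TTheory GRing.Theory Num.Theory.
Import numFieldNormedType.Exports.

Local Open Scope classical_set_scope.
Local Open Scope ring_scope.

(* Lebesgue measure on R^n, first on the product sigma-algebra of n.-tuple R
   (the (n+1)-dimensional measure is the image of lambda_1 x lambda_n under
   cons), then completed. *)

Section lebesgue_succ.
Context {R : realType} (n : nat).
Variable m : {sigma_finite_measure set (n.-tuple (measurableTypeR R)) -> \bar R}.

Definition tuple_cons (p : measurableTypeR R * n.-tuple (measurableTypeR R)) :
  n.+1.-tuple (measurableTypeR R) := [tuple of p.1 :: p.2].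

Lemma measurable_tuple_cons : measurable_fun setT tuple_cons.
Proof. by apply: measurable_cons; [exact: measurable_fst|exact: measurable_snd]. Qed.

Definition lebesgue_succ : set (n.+1.-tuple (measurableTypeR R)) -> \bar R :=
  pushforward (@lebesgue_measure R \x m)%E tuple_cons.

Let lebesgue_succ0 : lebesgue_succ set0 = 0%E.
Proof. by rewrite /lebesgue_succ /pushforward preimage_set0 measure0. Qed.

Let lebesgue_succ_ge0 A : (0 <= lebesgue_succ A)%E.
Proof. exact: (measure_ge0 (@lebesgue_measure R \x m)%E). Qed.

Let lebesgue_succ_sigma_additive : semi_sigma_additive lebesgue_succ.
Proof.
move=> F mF tF mUF; rewrite /lebesgue_succ /pushforward preimage_bigcup.
apply: measure_semi_sigma_additive.
- by move=> k; rewrite -[X in measurable X]setTI; exact: measurable_tuple_cons.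
- apply/trivIsetP => /= i j _ _ ij; rewrite -preimage_setI.
  by move/trivIsetP : tF => /(_ _ _ _ _ ij) ->//; rewrite preimage_set0.
- rewrite -preimage_bigcup -[X in measurable X]setTI.
  exact: measurable_tuple_cons.
Qed.

HB.instance Definition _ := isMeasure.Build _ _ _ lebesgue_succ
  lebesgue_succ0 lebesgue_succ_ge0 lebesgue_succ_sigma_additive.

Let lebesgue_succ_sigma_finite : sigma_finite setT lebesgue_succ.
Proof.
have /sigma_finiteP[F [FT ndF Foo]] := sigma_finiteT (@lebesgue_measure R).
have /sigma_finiteP[G [GT ndG Goo]] := sigma_finiteT m.
pose tl (t : n.+1.-tuple (measurableTypeR R)) : n.-tuple _ := [tuple of behead t].
have mtl : measurable_fun setT tl by exact: measurable_behead.
pose H k := [set t : n.+1.-tuple (measurableTypeR R) |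
  F k (tnth t ord0) /\ G k (tl t)].
have HE k : tuple_cons @^-1` H k = F k `*` G k.
  have bK x (t : n.-tuple (measurableTypeR R)) :
    tl (tuple_cons (x, t)) = t by exact/val_inj.
  by apply/seteqP; split => -[x t]; rewrite /H/= bK.
have mH k : measurable (H k).
  rewrite (_ : H k = (fun t : n.+1.-tuple (measurableTypeR R) => tnth t ord0)
    @^-1` F k `&` tl @^-1` G k)//.
  apply: measurableI; rewrite -[X in measurable X]setTI.
  - by apply: measurable_tnth => //; exact: (Foo k).1.
  - by apply: mtl => //; exact: (Goo k).1.
exists H.
  apply/seteqP; split => // t _.
  have [i _ Fi] : (\bigcup_i F i) (tnth t ord0) by rewrite -FT.
  have [j _ Gj] : (\bigcup_i G i) (tl t) by rewrite -GT.
  exists (maxn i j) => //; split.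
  - by move: Fi; exact/subsetPset/ndF/leq_maxl.
  - by move: Gj; exact/subsetPset/ndG/leq_maxr.
move=> k; split => //; have [mF Fk] := Foo k; have [mG Gk] := Goo k.
rewrite /lebesgue_succ /pushforward HE product_measure1E//.
by rewrite lte_mul_pinfty// ge0_fin_numE.
Qed.

HB.instance Definition _ := Measure_isSigmaFinite.Build _ _ _ lebesgue_succ
  lebesgue_succ_sigma_finite.

End lebesgue_succ.

Section euclidean.
Context {R : realType}.
Local Open Scope ereal_scope.

Fixpoint borel_lebesgue (n : nat) :
    {sigma_finite_measure set (n.-tuple (measurableTypeR R)) -> \bar R} :=
  match n with
  | 0%N => @dirac _ (0.-tuple (measurableTypeR R)) [tuple] R
  | k.+1 => lebesgue_succ (borel_lebesgue k)
  end.

End euclidean.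

(* R^n with the sigma-algebra of Lebesgue measurable sets, obtained as the
   Caratheodory sets of the outer measure generated by borel_lebesgue. *)
Definition euclid (R : realType) (n : nat) : Type := n.-tuple (measurableTypeR R).

Definition euclid_display : measure_display.
Proof. exact: default_measure_display. Qed.

Section euclid_lebesgue.
Context {R : realType} {n : nat}.
Local Open Scope ereal_scope.

Definition leb : set (euclid R n) -> \bar R := mu_ext (@borel_lebesgue R n).

HB.instance Definition _ :=
  Pointed.copy (euclid R n) (n.-tuple (measurableTypeR R)).

HB.instance Definition _ := isOuterMeasure.Build R (euclid R n) leb
  (outer_measure0 (mu_ext (@borel_lebesgue R n)))
  (outer_measure_ge0 (mu_ext (@borel_lebesgue R n)))
  (le_outer_measure (mu_ext (@borel_lebesgue R n)))
  (outer_measure_sigma_subadditive (mu_ext (@borel_lebesgue R n))).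

HB.instance Definition _ := @isMeasurable.Build euclid_display (euclid R n)
  leb.-caratheodory (caratheodory_measurable_set0 _)
  (@caratheodory_measurable_setC _ _ _) (@caratheodory_measurable_bigcup _ _ _).

HB.instance Definition _ := isMeasure.Build _ _ _ leb
  (outer_measure0 leb) (outer_measure_ge0 leb)
  (@caratheodory_measure_sigma_additive R (euclid R n) leb).

Definition coord (x : euclid R n) (i : 'I_n) : R := tnth x i.

End euclid_lebesgue.

Section young.
Context {R : realType}.
Implicit Type Phi : R -> R.

(* Functions on [0, +oo[ are represented by functions on R whose values at
   negative arguments are irrelevant. *)
Record young Phi : Prop := Young {
  young_ge0 : forall t : R, 0 <= t -> 0 <= Phi t ;
  young_continuous : {within `[0, +oo[, continuous Phi} ;
  young_convex : convex_function (`[0, +oo[%classic : set R) (Phi : R -> R^o) ;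
  young_increasing : {in `[0, +oo[ &, {homo Phi : s t / s < t}} ;
  young_at0 : Phi t / t @[t --> 0^'+] --> 0 ;
  young_aty : Phi t / t @[t --> +oo] --> +oo }.

Definition young_inv Phi : R -> R := 'pinv_(fun=> 0) `[0, +oo[ Phi.

Definition young_inv_le A B Phi :=
  exists2 c : R, 0 < c & forall t : R, 0 < t ->
    young_inv A t * young_inv B t <= c * young_inv Phi t.

End young.

Section maximal.
Context {R : realType} {n : nat}.
Local Open Scope ereal_scope.
Implicit Types (Phi : R -> R) (f g w : euclid R n -> \bar R).

Definition weight w :=
  measurable_fun setT w /\ {ae leb, forall x, 0 < w x < +oo}.

(* Open cubes; closed or half-open ones yield the same maximal functions. *)
Definition cube (a : euclid R n) (l : R) : set (euclid R n) :=
  [set x | forall i, (coord a i < coord x i < coord a i + l)%R].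

Definition is_cube (Q : set (euclid R n)) :=
  exists a l, (0 < l)%R /\ Q = cube a l.

(* er_map extends Phi by Phi (+oo) = +oo. *)
Definition luxemburg Phi (Q : set (euclid R n)) f : \bar R :=
  ereal_inf [set l%:E | l in [set l : R | (0 < l)%R /\
    (leb Q)^-1 * \int[leb]_(x in Q) er_map Phi (`|f x| * (l^-1)%:E)
      <= 1]].

Definition maximal Phi f : euclid R n -> \bar R := fun x =>
  ereal_sup [set luxemburg Phi Q f | Q in [set Q | is_cube Q /\ Q x]].

Definition dual_maximal Phi w f : euclid R n -> \bar R := fun x =>
  if w x == 0 then 0 else maximal Phi (fun y => f y * w y) x / w x.

Definition lpnorm (p : R) w f : \bar R :=
  (\int[leb]_x (`|f x| `^ p * w x)) `^ p^-1.

End maximal.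

Section bfs.
Context {R : realType} {n : nat}.
Local Open Scope ereal_scope.
Implicit Types (f g w : euclid R n -> \bar R) (E : set (euclid R n)).
Implicit Types (N : (euclid R n -> \bar R) -> \bar R).

(* A space is represented by its norm, which takes the value +oo outside the
   space; only its values at measurable functions are meaningful. *)
Record is_bfs w N : Prop := IsBFS {
  bfs_ge0 : forall f, measurable_fun setT f -> 0 <= N f ;
  bfs_abs : forall f, measurable_fun setT f -> N f = N (fun x => `|f x|) ;
  bfs_eq0 : forall f, measurable_fun setT f ->
    (N f = 0 <-> {ae leb, forall x, f x = 0}) ;
  bfs_triangle : forall f g, measurable_fun setT f -> measurable_fun setT g ->
    N (fun x => f x + g x) <= N f + N g ;
  bfs_scale : forall (l : R) f, measurable_fun setT f ->
    N (fun x => l%:E * f x) = `|l|%:E * N f ;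
  bfs_le : forall f g, measurable_fun setT f -> measurable_fun setT g ->
    {ae leb, forall x, `|f x| <= `|g x|} -> N f <= N g ;
  bfs_fatou : forall (h : (euclid R n -> \bar R)^nat) f,
    (forall j, measurable_fun setT (h j)) -> measurable_fun setT f ->
    {ae leb, forall x, (forall j, `|h j x| <= `|h j.+1 x|) /\
                           `|h j x| @[j --> \oo] --> `|f x|} ->
    (forall j, N (h j) <= N (h j.+1)) /\ N (h j) @[j --> \oo] --> N f ;
  bfs_indic : forall E, measurable E -> \int[leb]_(x in E) w x < +oo ->
    N (fun x => (\1_E x)%:E) < +oo /\
    exists2 C : R, (0 < C)%R & forall f, measurable_fun setT f ->
      \int[leb]_(x in E) (`|f x| * w x) <= C%:E * N f }.

Definition associate w N f : \bar R :=
  ereal_sup [set \int[leb]_x (`|f x * g x| * w x) |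
    g in [set g | measurable_fun setT g /\ N g <= 1]].

Definition power_norm (p : R) N f : \bar R :=
  (N (fun x => `|f x| `^ p)) `^ p^-1.

Definition extrapolation_family
    (F : set ((euclid R n -> \bar R) * (euclid R n -> \bar R))) :=
  forall f g, F (f, g) ->
    [/\ measurable_fun setT f, forall x, 0 <= f x,
        measurable_fun setT g & forall x, 0 <= g x].

End bfs.

(* Main.v *)
Require Import Defs.
From HB Require Import structures.
From mathcomp Require Import all_boot all_order all_algebra.
From mathcomp Require Import all_classical all_reals all_analysis.
From mathcomp Require Import measurable_realfun.
From mathcomp Require Import ring lra.

(** Put Y = X^(1/p0), so that the norm of f u in X, raised to the power p0, is
    the norm of (f u)^p0 in Y.  Since Y is a Banach function space, this norm
    is recovered by duality: it is at most K as soon as the integral of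
    (f u)^p0 h v is at most K for all h in a ball of the associate space
    ([lorentz_luxemburg]).  Fix such an h and use w0 = u^p0 h v as the weight
    in the extrapolation hypothesis.  This replaces f^p0 w0 by
    g^p0 M_Phi w0, and a generalized Hoelder inequality for Orlicz averages
    ([maximal_hoelder]) splits M_Phi w0 in one of two ways,

      M_Phi (u^p0 h v) <= c M_A (u^p0) M_B (h v)       for the first part,
      M_Phi (u^p0 h v) <= c M_A v M_B (u^p0 h)         for the second one.

    In both cases the last factor is the dual maximal function of h times the
    weight v or u^p0, so that the Hoelder inequality between the target space
    and its associate space ([dual_hoelder]), together with the assumed bound
    for the dual maximal operator, ends the proof.  The two parts differ only in
    the factorization of w0, and [extrapolation_step] treats them together.

    Two points need care.  The function w0 must be positive almost everywhere
    to be a weight, so h is first increased by a function of the associate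
    space that vanishes nowhere ([weak_unit]).  And duality is proved without
    the Hahn-Banach theorem or the duality between L^1 and L^oo: for a bounded
    f supported in a set of finite measure and of norm larger than 1,
    let s0 be the point of the unit ball closest to f in L^2; then the residual
    f - s0 is a functional that separates f from the unit ball
    ([unit_ball_separation]).  The minimizer exists because a minimizing
    sequence is Cauchy, by the parallelogram law, and the unit ball is stable
    under lower limits, by the Fatou property of the norm. *)

Set Implicit Arguments.
Unset Strict Implicit.
Unset Printing Implicit Defensive.

Import Order.TTheory GRing.Theory Num.Theory.
Import numFieldNormedType.Exports.

Local Open Scope classical_set_scope.
Local Open Scope ring_scope.
Local Open Scope ereal_scope.

(** * Lebesgue measure of cubes *)

Section lebesgue_euclid.
Context {R : realType} {n : nat}.
Implicit Types (a x : euclid R n) (l : R).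

Lemma borel_measurable_euclid (E : set (n.-tuple (measurableTypeR R))) :
  measurable E -> measurable (E : set (euclid R n)).
Proof. exact: (@caratheodory_measurable_mu_ext _ _ _ (borel_lebesgue n)). Qed.

Lemma leb_borel (E : set (n.-tuple (measurableTypeR R))) :
  measurable E -> leb (E : set (euclid R n)) = borel_lebesgue n E.
Proof. exact: measurable_mu_extE. Qed.

Lemma sigma_finite_leb : sigma_finite [set: euclid R n] leb.
Proof.
have [G GT Goo] := sigma_finiteT (@borel_lebesgue R n).
exists G => // k; have [mG Gk] := Goo k.
split; [exact: borel_measurable_euclid|by rewrite leb_borel].
Qed.

End lebesgue_euclid.

Section cube.
Context {R : realType}.

Lemma borel_cube n (a : euclid R n) (l : R) :
  measurable (cube a l : set (n.-tuple (measurableTypeR R))).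
Proof.
rewrite (_ : cube a l = \bigcap_(i in [set: 'I_n])
  ((fun t : n.-tuple (measurableTypeR R) => tnth t i) @^-1`
    `]tnth a i, (tnth a i + l)%R[)).
  apply: fin_bigcap_measurable => // i _; rewrite -[X in measurable X]setTI.
  exact: measurable_tnth.
apply/seteqP; split => x /= ax.
  by move=> i _; rewrite /= in_itv/=; exact: ax.
by move=> i; have := ax i I; rewrite /= in_itv.
Qed.

Lemma measurable_cube n (a : euclid R n) (l : R) : measurable (cube a l).
Proof. exact: borel_measurable_euclid (borel_cube a l). Qed.

Lemma leb_cube n (a : euclid R n) (l : R) : (0 < l)%R -> leb (cube a l) = (l ^+ n)%:E.
Proof.
move=> l0; rewrite leb_borel; last exact: borel_cube.
elim: n a => [|n IH] a.
  rewrite /= diracE (_ : cube a l = setT) ?in_setT ?expr0//.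
  by apply/seteqP; split => // x _ [].
rewrite /= /lebesgue_succ /pushforward.
rewrite (_ : _ @^-1` _ = `]tnth a ord0, (tnth a ord0 + l)%R[ `*`
  (cube (behead_tuple a : euclid R n) l : set (n.-tuple (measurableTypeR R)))).
  rewrite product_measure1E//; last exact: borel_cube.
  rewrite IH; set I := (X in X * _); suff -> : I = l%:E by rewrite -EFinM exprS.
  rewrite /I; apply: etrans (lebesgue_measure_itv _) _ => /=.
  by rewrite lte_fin ltrDl l0 -EFinD addrAC subrr add0r.
apply/seteqP; split => -[x t]; rewrite /cube /Defs.coord /=.
  move=> h; split => [|i]; first by have := h ord0; rewrite in_itv.
  by have := h (lift ord0 i); rewrite !(tnth_nth 0%R)/= !nth_behead.
move=> [h1 h2] i; case: (unliftP ord0 i) => [j ->|->].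
  by have := h2 j; rewrite !(tnth_nth 0%R)/= !nth_behead.
by move: h1; rewrite in_itv.
Qed.

End cube.

(** * Measurability of maximal functions *)

Section maximal_measurable.
Context {R : realType} {n : nat}.

(** Although the union may be uncountable, each of its points lies in a cube
    with rational corner and side contained in the union, and there are only
    countably many of these. *)
Lemma measurable_union_cubes (U : set (euclid R n)) :
  (forall x, U x -> exists Q, [/\ is_cube Q, Q x & Q `<=` U]) -> measurable U.
Proof.
move=> UQ; pose c (q : n.-tuple rat * rat) : set (euclid R n) :=
  cube (map_tuple ratr q.1 : euclid R n) (ratr q.2).
rewrite (_ : U = \bigcup_q (c q `&` [set _ | c q `<=` U])).
  apply: countable_bigcupT_measurable => // q.
  have [qU|qU] := pselect (c q `<=` U).
    rewrite (_ : [set _ | _] = setT) ?setIT; first exact: measurable_cube.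
    by apply/seteqP; split.
  by rewrite (_ : [set _ | _] = set0) ?setI0//; apply/seteqP; split.
apply/seteqP; split => [x /UQ[_ [[a [l [l0 ->]]] ax aU]]|]; last first.
  by move=> x [q _ [qx]]; exact.
(* d i is the distance from x to the nearer face orthogonal to axis i; a
   rational cube around x with side below all of these stays inside the given
   cube. *)
pose d i := Num.min (Defs.coord x i - Defs.coord a i)%R (Defs.coord a i + l - Defs.coord x i)%R.
have d0 : (0 < \big[Num.min/1%R]_i d i)%R.
  by apply: lt_bigmin => // i _; rewrite lt_min !subr_gt0; exact: ax.
have [r] := rat_in_itvoo d0; rewrite in_itv/= => /andP[r0 rd].
have /choice[b xb] : forall i, exists q : rat,
    (Defs.coord x i - ratr r < ratr q < Defs.coord x i)%R.
  move=> i; have /rat_in_itvoo[q] : (Defs.coord x i - ratr r < Defs.coord x i)%R.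
    by rewrite ltrBlDr ltrDl.
  by rewrite in_itv/=; exists q.
have cE i : Defs.coord (map_tuple ratr (mktuple b) : euclid R n) i = ratr (b i).
  by rewrite /Defs.coord tnth_map tnth_mktuple.
exists (mktuple b, r) => //; split => [i|] /=.
  by rewrite cE; have /andP[b1 b2] := xb i; rewrite b2 -ltrBlDr.
move=> y cy; apply: aU => i; have := cy i; rewrite cE /= => /andP[y1 y2].
have : (ratr r < d i)%R by apply: lt_le_trans rd _; exact: bigmin_le.
rewrite lt_min => /andP[d1 d2]; have /andP[b1 b2] := xb i.
by apply/andP; split; lra.
Qed.

(** A maximal function is lower semicontinuous: if it exceeds t at x, the
    cube that witnesses this witnesses it at all of its points. *)
Lemma measurable_maximal (Phi : R -> R) (f : euclid R n -> \bar R) :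
  measurable_fun setT (maximal Phi f).
Proof.
apply: (measurability _ (ErealGenOInfty.measurableE R)) => _ [_ [t ->] <-].
rewrite setTI; apply: measurable_union_cubes => x /=.
rewrite in_itv/= andbT => /ereal_sup_gt[_ [Q [cQ Qx] <-] tQ].
exists Q; split => // y Qy /=; rewrite in_itv/= andbT.
by apply: lt_le_trans tQ _; apply: ereal_sup_ubound; exists Q.
Qed.

End maximal_measurable.

(** * Young functions and their inverses *)

Section gauge.
Context {R : realType}.
Local Open Scope ring_scope.

(** The common features of Young functions and of the identity: they are
    increasing bijections of [0, +oo[ which are convex between 0 and any other
    point. *)
Record gauge (Phi : R -> R) : Prop := Gauge {
  gauge0 : Phi 0 = 0%R ;
  gauge_lt : {in `[0, +oo[ &, {homo Phi : s t / (s < t)%R}} ;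
  gauge_star : forall a t : R, (0 <= a <= 1)%R -> (0 <= t)%R ->
    (Phi (a * t) <= a * Phi t)%R ;
  gauge_surj : forall y : R, (0 <= y)%R -> exists2 t, (0 <= t)%R & Phi t = y }.

Lemma gauge_id (Phi : R -> R) : (forall t, (0 <= t)%R -> Phi t = t) -> gauge Phi.
Proof.
move=> Phid; split => [|s t|a t /andP[a0 _] t0|y y0].
- by rewrite Phid.
- by rewrite !in_itv/= !andbT => s0 t0 st; rewrite !Phid.
- by rewrite !Phid// mulr_ge0.
- by exists y => //; exact: Phid.
Qed.

Lemma young_gauge (Phi : R -> R) : young Phi -> gauge Phi.
Proof.
case=> ge0 cont conv incr at0 aty.
have pos t : (0 <= t)%R -> t \in `[0%R, +oo[ by rewrite in_itv/= andbT.
have mono s t : (0 <= s)%R -> (s <= t)%R -> (Phi s <= Phi t)%R.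
  move=> s0; rewrite le_eqVlt => /predU1P[->//|st].
  by apply/ltW/incr => //; apply: pos => //; exact: le_trans (ltW st).
have Phi0 : Phi 0 = 0%R.
  apply/eqP; rewrite eq_le ge0// andbT leNgt; apply/negP => P0.
  have h1 : \forall t \near 0^'+, (Phi t / t < 1)%R.
    by apply: (cvgr_lt 0%R) => //; exact: at0.
  near (0 : R)^'+ => t.
  have t0 : (0 < t)%R by near: t; exact: nbhs_right_gt.
  have tP : (t < Phi 0)%R by near: t; exact: nbhs_right_lt.
  have : (Phi t / t < 1)%R by near: t.
  rewrite ltr_pdivrMr// mul1r ltNge => /negP; apply.
  exact: le_trans (ltW tP) (mono _ _ _ (ltW t0)).
split => // [a t /andP[a0 a1] t0|y y0].
- have := @conv (Itv01 a0 a1) t 0%R.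
  rewrite !inE/= !in_itv/= !lexx !andbT => /(_ t0 isT).
  rewrite convRE/= Phi0 mulr0 addr0; apply: le_trans.
  rewrite le_eqVlt; apply/predU1P; left; congr Phi; apply/esym.
  by apply: etrans (convRE _ _ _) _; rewrite mulr0 addr0.
(* Phi t / t > y at some t >= 1 gives Phi t > y, and Phi 0 = 0: conclude by the
   intermediate value theorem. *)
- have h1 : \forall t \near +oo, (y < Phi t / t)%R.
    exact: (cvgryPgt _).1 aty _.
  near (+oo%R : set_system R) => t.
  have t1 : (1 <= t)%R by near: t; apply: nbhs_pinfty_ge; exact: num_real.
  have t0 : (0 <= t)%R by apply: le_trans t1.
  have : (y < Phi t / t)%R by near: t.
  rewrite ltr_pdivlMr ?(lt_le_trans _ t1)// => yt.
  have [||c] := @IVT _ Phi 0%R t y t0.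
  + apply: continuous_subspaceW cont => x /=.
    by rewrite !in_itv/= => /andP[->].
  + rewrite Phi0 ge_min y0 le_max/=; apply/orP; right.
    by apply: le_trans (ltW yt); rewrite ler_peMr.
  + by rewrite in_itv/= => /andP[c0 _] <-; exists c.
Unshelve. all: by end_near. Qed.

Section gauge_theory.
Variable Phi : R -> R.
Hypothesis gPhi : gauge Phi.

Lemma gauge_le (s t : R) : (0 <= s)%R -> (s <= t)%R -> (Phi s <= Phi t)%R.
Proof.
move=> s0; rewrite le_eqVlt => /predU1P[->//|st].
apply/ltW/(gauge_lt gPhi) => //; rewrite in_itv/= andbT//.
exact: le_trans (ltW st).
Qed.

Lemma gauge_ge0 (t : R) : (0 <= t)%R -> (0 <= Phi t)%R.
Proof. by move=> t0; rewrite -(gauge0 gPhi); exact: gauge_le. Qed.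

Lemma gauge_gt0 (t : R) : (0 < t)%R -> (0 < Phi t)%R.
Proof.
move=> t0; rewrite -(gauge0 gPhi); apply: (gauge_lt gPhi) => //.
- by rewrite in_itv/= lexx.
- by rewrite in_itv/= ltW.
Qed.

Lemma gauge_inv (y : R) : (0 <= y)%R ->
  (0 <= young_inv Phi y)%R /\ Phi (young_inv Phi y) = y.
Proof.
move=> y0; have [t t0 ty] := gauge_surj gPhi y0.
have imy : (Phi @` `[0%R, +oo[) y by exists t; rewrite //= in_itv/= t0.
split; last by apply: pinvK; rewrite inE.
have inj : {in (`[0%R, +oo[%classic : set R) &, injective Phi}.
  move=> a b; rewrite !inE => a0 b0 ab; have [lt|lt|//] := ltgtP a b.
    by have := gauge_lt gPhi a0 b0 lt; rewrite ab ltxx.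
  by have := gauge_lt gPhi b0 a0 lt; rewrite ab ltxx.
have : ('pinv_(fun=> 0%R) `[0%R, +oo[ Phi @` (Phi @` `[0%R, +oo[))
    (young_inv Phi y) by exists y.
by rewrite injpinv_image//= in_itv/= andbT.
Qed.

Lemma gauge_le_inv (s y : R) : (0 <= s)%R -> (Phi s <= y)%R ->
  (s <= young_inv Phi y)%R.
Proof.
move=> s0 sy; have y0 : (0 <= y)%R by apply: le_trans sy; exact: gauge_ge0.
have [i0 iE] := gauge_inv y0; rewrite leNgt; apply/negP => /(gauge_lt gPhi).
by rewrite iE !in_itv/= !andbT => /(_ i0 s0); rewrite ltNge sy.
Qed.

End gauge_theory.

(** With y = A s + B t, s is at most A^-1 y and t at most B^-1 y, hence
    s t <= c Phi^-1 y and Phi (s t / c) <= y.  The factor 2 is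
    absorbed in the constant by convexity; thus averages of A and B
    that are at most 1 yield an average of Phi that is at most 1. *)
Lemma gauge_young_ineq (Phi A B : R -> R) : gauge Phi -> gauge A -> gauge B ->
  young_inv_le A B Phi -> exists2 c : R, (0 < c)%R & forall s t : R,
    (0 <= s)%R -> (0 <= t)%R -> (Phi (c^-1 * (s * t)) <= 2^-1 * (A s + B t))%R.
Proof.
move=> gPhi gA gB [c c0 ABP]; exists (2 * c)%R; first by rewrite mulr_gt0.
have key s t y : (0 <= s)%R -> (0 <= t)%R -> (0 < y)%R ->
    (A s <= y)%R -> (B t <= y)%R -> (Phi (c^-1 * (s * t)) <= y)%R.
  move=> s0 t0 y0 Asy Bty; have [i0 iE] := gauge_inv gPhi (ltW y0).
  rewrite -[leRHS]iE; apply: gauge_le => //.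
    by rewrite !mulr_ge0// invr_ge0 ltW.
  rewrite ler_pdivrMl//; apply: le_trans (ABP _ y0).
  by apply: ler_pM => //; exact: gauge_le_inv.
move=> s t s0 t0.
have cst0 : (0 <= c^-1 * (s * t))%R by rewrite !mulr_ge0// invr_ge0 ltW.
rewrite invfM -mulrA (le_trans (gauge_star gPhi _ _))//.
  by rewrite invr_ge0 ler0n invf_le1// ler1n.
rewrite ler_pM2l ?invr_gt0//.
have As0 := gauge_ge0 gA s0; have Bt0 := gauge_ge0 gB t0.
have : (0 <= A s + B t)%R by exact: addr_ge0.
rewrite le_eqVlt eq_sym => /predU1P[AB0|AB0]; last by apply: key => //; lra.
(* y = 0 is outside of the hypothesis on inverses, but then s = 0. *)
have s_eq0 : s = 0%R.
  apply/eqP; rewrite eq_le s0 andbT leNgt; apply/negP => /(gauge_gt0 gA).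
  by lra.
by rewrite AB0 s_eq0 mul0r mulr0 (gauge0 gPhi).
Qed.

End gauge.

(** * Hoelder's inequality in Orlicz averages *)

Section orlicz_modular.
Context d (T : measurableType d) {R : realType} (mu : {measure set T -> \bar R}).
Implicit Types (Phi A B : R -> R) (F G : T -> \bar R) (Q : set T).

Lemma er_gauge_ge0 Phi (y : \bar R) : gauge Phi -> 0 <= y -> 0 <= er_map Phi y.
Proof. by move=> gP; case: y => //= y; rewrite !lee_fin; exact: gauge_ge0. Qed.

Lemma measurable_er_gauge Phi F : gauge Phi -> measurable_fun setT F ->
  measurable_fun setT (fun x => er_map Phi `|F x|).
Proof.
move=> gP mF.
(* Phi is arbitrary on negative numbers; P agrees with it where it matters and
   is monotone, hence measurable. *)
pose P t := Phi (Num.max 0 t)%R.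
have -> : (fun x => er_map Phi `|F x|) = er_map P \o (abse \o F).
  apply/funext => x /=; case: (F x) => //= r.
  by rewrite /P; congr (Phi _)%:E; rewrite max_r.
apply: measurableT_comp; last exact: measurableT_comp.
apply: (@measurable_er_map _ (measurableTypeR R)).
apply: nondecreasing_measurable => // s t st; apply: (gauge_le gP).
  by rewrite le_max lexx.
by rewrite ge_max !le_max lexx st orbT.
Qed.

Lemma er_gauge_young Phi A B (c : R) : (0 < c)%R ->
  (forall s t : R, (0 <= s)%R -> (0 <= t)%R ->
    (Phi (c^-1 * (s * t)) <= 2^-1 * (A s + B t))%R) ->
  forall a b : \bar R, 0 <= a -> 0 <= b ->
  er_map Phi (c^-1%:E * (a * b)) <= 2^-1%:E * (er_map A a + er_map B b).
Proof.
move=> c0 h [a| |] [b| |]//=; rewrite ?lee_fin => a0 b0.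
- exact: h.
- by rewrite addey// [leRHS]gt0_muley ?leey// lte_fin invr_gt0.
- by rewrite addye// [leRHS]gt0_muley ?leey// lte_fin invr_gt0.
- by rewrite [leRHS]gt0_muley ?leey// lte_fin invr_gt0.
Qed.

Lemma abse_scale (y : \bar R) (k : R) : (0 < k)%R ->
  `|y| * k^-1%:E = `|y * k^-1%:E|.
Proof. by move=> k0; rewrite abseM/= gtr0_norm// invr_gt0. Qed.

Lemma measurable_er_gauge_scale Phi F (k : R) Q : (0 < k)%R -> gauge Phi ->
  measurable_fun setT F -> measurable_fun Q (fun x => er_map Phi (`|F x| * k^-1%:E)).
Proof.
move=> k0 gP mF; apply: measurable_funTS; under eq_fun do rewrite abse_scale//.
by apply: measurable_er_gauge => //; exact: emeasurable_funM.
Qed.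

Lemma er_gauge_scale_ge0 Phi F (k : R) x : (0 < k)%R -> gauge Phi ->
  0 <= er_map Phi (`|F x| * k^-1%:E).
Proof.
by move=> k0 gP; apply: er_gauge_ge0 => //; rewrite mule_ge0// lee_fin invr_ge0 ltW.
Qed.

(** The inequality behind [luxemburgM]; k stands for the inverse of the
    measure of Q. *)
Lemma modularM Phi A B (c : R) (k : \bar R) Q F G (l m : R) :
  gauge A -> gauge B -> gauge Phi -> (0 < c)%R ->
  (forall s t : R, (0 <= s)%R -> (0 <= t)%R ->
    (Phi (c^-1 * (s * t)) <= 2^-1 * (A s + B t))%R) ->
  measurable Q -> measurable_fun setT F -> measurable_fun setT G ->
  (0 < l)%R -> (0 < m)%R -> 0 <= k ->
  k * \int[mu]_(x in Q) er_map A (`|F x| * l^-1%:E) <= 1 ->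
  k * \int[mu]_(x in Q) er_map B (`|G x| * m^-1%:E) <= 1 ->
  k * \int[mu]_(x in Q) er_map Phi (`|F x * G x| * (c * (l * m))^-1%:E) <= 1.
Proof.
move=> gA gB gP c0 h mQ mF mG l0 m0 k0 Al Bm.
have lm0 : (0 < c * (l * m))%R by rewrite !mulr_gt0.
have mFG : measurable_fun setT (fun x => F x * G x) by exact: emeasurable_funM.
have mA := measurable_er_gauge_scale (Q := Q) l0 gA mF.
have mB := measurable_er_gauge_scale (Q := Q) m0 gB mG.
have mP := measurable_er_gauge_scale (Q := Q) lm0 gP mFG.
have A0 x := er_gauge_scale_ge0 F x l0 gA.
have B0 x := er_gauge_scale_ge0 G x m0 gB.
have P0 x := er_gauge_scale_ge0 (fun x => F x * G x) x lm0 gP.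
apply: (@le_trans _ _ (k * \int[mu]_(x in Q) (2^-1%:E *
    (er_map A (`|F x| * l^-1%:E) + er_map B (`|G x| * m^-1%:E))))).
  apply: lee_pmul => //; first by apply: integral_ge0 => x _; exact: P0.
  apply: ge0_le_integral => //.
  - by apply: emeasurable_funM => //; exact: emeasurable_funD.
  - move=> x _; have := er_gauge_young c0 h.
    move=> /(_ (`|F x| * l^-1%:E) (`|G x| * m^-1%:E)).
    rewrite !mule_ge0 ?lee_fin ?invr_ge0 ?(ltW l0) ?(ltW m0)// => /(_ isT isT); apply: le_trans.
    by rewrite abseM !invfM !EFinM [X in er_map _ X]muleCA muleACA.
rewrite ge0_integralZl//; [|exact: emeasurable_funD|by move=> x _; exact: adde_ge0].
rewrite ge0_integralD// muleCA ge0_muleDr; [|exact: integral_ge0..].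
apply: (@le_trans _ _ (2^-1%:E * (1 + 1))).
  apply: lee_pmul => //; last exact: leeD.
  by apply: adde_ge0; apply: mule_ge0 => //; exact: integral_ge0.
by rewrite -EFinD -EFinM mulVf.
Qed.

(** By convexity A (F) <= l A (F / l) for l <= 1, so the integral of A (F) over
    Q is at most l for arbitrarily small l. *)
Lemma modular_eq0 A F Q : gauge A -> measurable Q -> measurable_fun setT F ->
  (forall e : R, (0 < e)%R -> exists l : R, [/\ (0 < l)%R, (l < e)%R &
    \int[mu]_(x in Q) er_map A (`|F x| * l^-1%:E) <= 1]) ->
  {ae mu, forall x, Q x -> F x = 0}.
Proof.
move=> gA mQ mF Fl.
have mAF : measurable_fun Q (fun y => er_map A `|F y|).
  by apply: measurable_funTS; exact: measurable_er_gauge.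
have IA0 : \int[mu]_(y in Q) er_map A `|F y| = 0.
  apply/eqP; rewrite eq_le integral_ge0 ?andbT; last first.
    by move=> y _; exact: er_gauge_ge0.
  apply/lee_addgt0Pr => e e0; rewrite add0e.
  have /Fl[l [l0]] : (0 < Num.min 1 e)%R by rewrite lt_min ltr01.
  rewrite lt_min => /andP[l1 le] {}Fl.
  have mAl := measurable_er_gauge_scale (Q := Q) l0 gA mF.
  apply: (@le_trans _ _ (l%:E * \int[mu]_(y in Q) er_map A (`|F y| * l^-1%:E))).
    rewrite -ge0_integralZl//; [|by move=> y _; exact: er_gauge_scale_ge0|
      by rewrite lee_fin ltW].
    apply: ge0_le_integral => //.
    - by move=> y _; exact: er_gauge_ge0.
    - exact: emeasurable_funM.
    - move=> y _; case: (F y) => [r| |] //=; last 2 first.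
      + by rewrite !gt0_mulye ?lte_fin ?invr_gt0//= gt0_muley ?lte_fin.
      + by rewrite !gt0_mulye ?lte_fin ?invr_gt0//= gt0_muley ?lte_fin.
      rewrite lee_fin -[X in A X](_ : l * (`|r| * l^-1) = `|r|)%R.
        by apply: gauge_star => //; rewrite ?(ltW l0) ?(ltW l1)// divr_ge0// ltW.
      by rewrite mulrCA mulfV ?mulr1// gt_eqF.
  apply: (@le_trans _ _ (l%:E * 1)); last by rewrite mule1 lee_fin ltW.
  by apply: lee_wpmul2l => //; rewrite lee_fin ltW.
have : \int[mu]_(y in Q) `|er_map A `|F y| | = 0.
  by rewrite -[RHS]IA0; apply: eq_integral => y _; rewrite gee0_abs// er_gauge_ge0.
move/(ae_eq_integral_abs mu mQ mAF); apply: filterS => y AFy /AFy.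
case: (F y) => [r| |] //= [] Ar; congr _%:E; apply/eqP; rewrite -normr_le0 leNgt.
by apply/negP => /(gauge_gt0 gA); rewrite Ar ltxx.
Qed.

End orlicz_modular.

(** * Hoelder's inequality for maximal functions *)

Section maximal_hoelder.
Context {R : realType} {n : nat}.
Implicit Types (Phi A B : R -> R) (F G : euclid R n -> \bar R).

Definition unit_cube (x : euclid R n) : set (euclid R n) :=
  cube (mktuple (fun i => Defs.coord x i - 2^-1)%R : euclid R n) 1.

Lemma unit_cubeP (x : euclid R n) : is_cube (unit_cube x) /\ unit_cube x x.
Proof.
split; first by do 2 eexists; split; [exact: ltr01|].
move=> i; rewrite [X in (X < _)%R && _](_ : _ = Defs.coord x i - 2^-1)%R.
  rewrite [X in _ && (_ < X + _)%R](_ : _ = Defs.coord x i - 2^-1)%R.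
    by apply/andP; split; lra.
  by rewrite /Defs.coord tnth_mktuple.
by rewrite /Defs.coord tnth_mktuple.
Qed.

Lemma maximal_ge0 Phi F x : 0 <= maximal Phi F x.
Proof.
apply: (@le_trans _ _ (luxemburg Phi (unit_cube x) F)).
  by apply: le_ereal_inf_tmp => _ [l [l0 _] <-]; rewrite lee_fin ltW.
apply: ereal_sup_ubound; exists (unit_cube x); last by [].
exact: unit_cubeP.
Qed.

(** Generalized Hoelder inequality, stated with strict upper bounds l and m of
    the two norms because the infimum defining a norm need not be attained by
    a positive number. *)
Lemma luxemburgM Phi A B (c : R) Q F G (l m : R) :
  gauge A -> gauge B -> gauge Phi -> (0 < c)%R ->
  (forall s t : R, (0 <= s)%R -> (0 <= t)%R ->
    (Phi (c^-1 * (s * t)) <= 2^-1 * (A s + B t))%R) ->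
  measurable Q -> measurable_fun setT F -> measurable_fun setT G ->
  luxemburg A Q F < l%:E -> luxemburg B Q G < m%:E ->
  luxemburg Phi Q (fun x => F x * G x) <= (c * (l * m))%:E.
Proof.
move=> gA gB gP c0 h mQ mF mG /ereal_inf_lt[_ [l' [l'0 Fl'] <-]].
rewrite lte_fin => ll' /ereal_inf_lt[_ [m' [m'0 Gm'] <-]].
rewrite lte_fin => mm'.
have l'm'0 : (0 < c * (l' * m'))%R by rewrite !mulr_gt0.
apply: (@le_trans _ _ (c * (l' * m'))%:E); last first.
  by rewrite lee_fin ler_pM2l// ler_pM ?(ltW l'0) ?(ltW m'0) ?(ltW ll') ?(ltW mm').
apply: ereal_inf_lbound; exists (c * (l' * m'))%R; last by [].
split; first by [].
have Q0 : 0 <= (leb Q)^-1 by rewrite inve_ge0; exact: outer_measure_ge0.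
exact: (modularM gA gB gP c0 h mQ mF mG l'0 m'0 Q0 Fl' Gm').
Qed.

(** A zero norm on the unit cube around x would force F to vanish almost
    everywhere on this cube.  In the product of two maximal functions this
    positivity excludes the form 0 * +oo, whose value is 0. *)
Lemma maximal_gt0 A F x : gauge A -> measurable_fun setT F ->
  {ae leb, forall y, F y != 0} -> 0 < maximal A F x.
Proof.
move=> gA mF F0; rewrite ltNge; apply/negP => M0.
pose Q := unit_cube x.
have mQ : measurable Q by exact: measurable_cube.
have Q1 : leb Q = 1 by rewrite leb_cube ?ltr01// expr1n.
have lux0 : luxemburg A Q F <= 0.
  apply: le_trans M0; apply: ereal_sup_ubound; exists Q; last by [].
  exact: unit_cubeP.
have QF0 : {ae leb, forall y, Q y -> F y = 0}.
  apply: (modular_eq0 gA mQ mF) => e e0.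
  have /ereal_inf_lt[_ [l [l0 Fl] <-]] : luxemburg A Q F < e%:E.
    by apply: le_lt_trans lux0 _; rewrite lte_fin.
  by rewrite lte_fin => le; exists l; split => //; rewrite Q1 inve1 mul1e in Fl.
have : {ae leb, forall y, ~ Q y}.
  by apply: filterS2 F0 QF0 => y /eqP Fy QFy /QFy.
move=> negQ; have /(negligibleP _ mQ) Q0 : leb.-negligible Q.
  by apply: negligibleS negQ => y Qy /=; apply.
have : 1 = 0 :> \bar R by rewrite -Q1; exact: Q0.
by move/eqP; rewrite onee_eq0.
Qed.

Lemma le_mul_of_gt (a b c : R) (X : \bar R) : (0 <= c)%R ->
  (forall l m, (a < l)%R -> (b < m)%R -> X <= (c * (l * m))%:E) -> X <= (c * (a * b))%:E.
Proof.
move=> c0 H; apply/lee_addgt0Pr => e e0.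
pose k := (c * (1 + `|a| + `|b|) + 1)%R.
have k0 : (0 < k)%R by rewrite ltr_wpDl// mulr_ge0// !addr_ge0.
pose d := Num.min 1%R (e / k)%R.
have d0 : (0 < d)%R by rewrite lt_min ltr01 divr_gt0.
apply: le_trans (H (a + d)%R (b + d)%R _ _) _; rewrite ?ltrDl//.
rewrite -EFinD lee_fin.
have d1 : (d <= 1)%R by rewrite ge_min lexx.
have dk : (d * k <= e)%R by rewrite -ler_pdivlMr// ge_min lexx orbT.
have -> : (c * ((a + d) * (b + d)) = c * (a * b) + c * (d * (a + b + d)))%R by ring.
rewrite lerD2l; apply: le_trans dk; rewrite mulrCA ler_pM2l// /k.
apply: (@le_trans _ _ (c * (1 + `|a| + `|b|)))%R; last by rewrite lerDl.
by apply: ler_wpM2l => //; have := ler_norm a; have := ler_norm b; lra.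
Qed.

Lemma maximal_hoelder Phi A B : gauge Phi -> gauge A -> gauge B ->
  young_inv_le A B Phi -> exists2 c : R, (0 < c)%R &
  forall F G, measurable_fun setT F -> measurable_fun setT G ->
    {ae leb, forall y, F y != 0} -> {ae leb, forall y, G y != 0} ->
    forall x, maximal Phi (fun y => F y * G y) x
      <= c%:E * (maximal A F x * maximal B G x).
Proof.
move=> gP gA gB ABP; have [c c0 h] := gauge_young_ineq gP gA gB ABP.
exists c => // F G mF mG F0 G0 x.
move: (maximal_gt0 x gA mF F0) (maximal_gt0 x gB mG G0).
have : forall Q, is_cube Q -> Q x -> luxemburg A Q F <= maximal A F x.
  by move=> Q cQ Qx; apply: ereal_sup_ubound; exists Q.
have : forall Q, is_cube Q -> Q x -> luxemburg B Q G <= maximal B G x.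
  by move=> Q cQ Qx; apply: ereal_sup_ubound; exists Q.
case: (maximal A F x) => [a| |] //; case: (maximal B G x) => [b| |] // lB lA a0 b0;
  last 3 first.
- by rewrite [X in c%:E * X]gt0_muley// gt0_muley ?leey ?lte_fin.
- by rewrite [X in c%:E * X]gt0_mulye// gt0_muley ?leey ?lte_fin.
- by rewrite [X in c%:E * X]gt0_mulye// gt0_muley ?leey ?lte_fin.
rewrite -!EFinM; apply: ge_ereal_sup => _ [Q [cQ Qx] <-].
apply: le_mul_of_gt => [|l m al bm]; first exact: ltW.
apply: (luxemburgM gA gB) => //.
- by case: cQ => q [k [_ ->]]; exact: measurable_cube.
- by apply: le_lt_trans (lA _ cQ Qx) _; rewrite lte_fin.
- by apply: le_lt_trans (lB _ cQ Qx) _; rewrite lte_fin.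
Qed.

End maximal_hoelder.

(** * The point of a convex set nearest to f in L^2 *)

(** C is a convex set of measurable functions between 0 and f, stable under
    lower limits of sequences; f is bounded and supported in a set of finite
    measure. *)
Section L2_projection.
Context d (T : measurableType d) {R : realType} (mu : {measure set T -> \bar R}).
Variables (E : set T) (f : T -> R) (M : R).
Hypotheses (mE : measurable E) (Eoo : mu E < +oo).
Hypotheses (mf : measurable_fun setT f) (f0 : forall x, (0 <= f x)%R).
Hypotheses (fM : forall x, (f x <= M)%R) (fE : forall x, ~ E x -> f x = 0%R).
Variable C : set (T -> R).
Hypothesis mC : forall s, C s -> measurable_fun setT s.
Hypothesis C0 : forall s x, C s -> (0 <= s x <= f x)%R.
Hypothesis Cmid : forall s t, C s -> C t -> C (fun x => 2^-1 * (s x + t x))%R.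
Hypothesis Climinf : forall s : (T -> R)^nat, (forall k, C (s k)) ->
  C (fun x => sup (range (infs (s ^~ x)))).

Definition sqdist (s : T -> R) : \bar R := \int[mu]_x ((f x - s x) ^+ 2)%:E.

Lemma measurable_sq (s : T -> R) : measurable_fun setT s ->
  measurable_fun setT (fun x => ((s x) ^+ 2)%:E).
Proof. by move=> ms; apply/measurable_EFinP; exact: measurable_funX. Qed.

Lemma measurable_sqdist (s : T -> R) : measurable_fun setT s ->
  measurable_fun setT (fun x => ((f x - s x) ^+ 2)%:E).
Proof. by move=> ms; apply: measurable_sq; exact: measurable_funB. Qed.

Lemma sqdist_ge0 s : 0 <= sqdist s.
Proof. by apply: integral_ge0 => x _; rewrite lee_fin sqr_ge0. Qed.

Lemma sqdist_lty s : C s -> sqdist s < +oo.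
Proof.
move=> Cs; apply: (@le_lt_trans _ _ (\int[mu]_x ((M ^+ 2)%:E * (\1_E x)%:E))).
  apply: ge0_le_integral => //.
  - by move=> x _; rewrite lee_fin sqr_ge0.
  - by apply: measurable_sqdist; exact: mC.
  - apply: emeasurable_funM => //; apply/measurable_EFinP; exact: measurable_indic.
  - move=> x _; rewrite -EFinM lee_fin indicE; have := C0 x Cs; have := fM x.
    have [xE|xE] := boolP (x \in E); first by rewrite /= => ? ?; nra.
    rewrite fE; last by move=> /mem_set; rewrite (negbTE xE).
    move=> _ /andP[a b]; have -> : s x = 0%R by apply/eqP; rewrite eq_le a b.
    by rewrite subr0 expr0n mulr0.
rewrite ge0_integralZl ?lee_fin ?sqr_ge0//; last first.
  by apply/measurable_EFinP; exact: measurable_indic.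
by rewrite integral_indic// setIT lte_mul_pinfty// lee_fin sqr_ge0.
Qed.

Lemma sqdist_parallelogram s t : C s -> C t ->
  \int[mu]_x ((s x - t x) ^+ 2)%:E + 4%:E * sqdist (fun x => 2^-1 * (s x + t x))%R
  = 2%:E * sqdist s + 2%:E * sqdist t.
Proof.
move=> Cs Ct; have ms := mC Cs; have mt := mC Ct; have mst := mC (Cmid Cs Ct).
have sq0 (h : T -> R) x : setT x -> 0 <= (h x ^+ 2)%:E by rewrite lee_fin sqr_ge0.
have sqc0 (h : T -> R) (c : R) x : (0 <= c)%R -> 0 <= c%:E * (h x ^+ 2)%:E.
  by move=> c0; rewrite mule_ge0 ?lee_fin// sqr_ge0.
rewrite /sqdist -!ge0_integralZl ?lee_fin//; try by [exact: measurable_sqdist |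
  move=> x _; rewrite lee_fin sqr_ge0].
have mZ (c : R) (h : T -> R) : measurable_fun setT h ->
    measurable_fun setT (fun x => c%:E * ((f x - h x) ^+ 2)%:E).
  by move=> mh; apply: emeasurable_funM => //; exact: measurable_sqdist.
rewrite -!ge0_integralD//; try by [exact: mZ|
  move=> x _; apply: (sqc0 (fun x => f x - _)%R); rewrite ?ler0n//].
- by apply: eq_integral => x _; rewrite -!EFinM -!EFinD; congr _%:E; field.
- by move=> x _; rewrite lee_fin sqr_ge0.
- by apply: measurable_sq; exact: measurable_funB.
Qed.

(** By the parallelogram law a minimizing sequence s is Cauchy in L^2, and so
    fast that the sum of the differences |s k - s (k + 1)| is integrable.  Let
    I k be the infimum of the tail s k, s (k + 1), etc.  Since 0 <= s k - I k
    is at most the tail of this sum, passing from s k to I k, and then to the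
    larger function l = sup I k <= f, costs an amount which tends to 0. *)
Lemma sqdist_minimizer : C !=set0 ->
  exists2 s0, C s0 & forall s, C s -> sqdist s0 <= sqdist s.
Proof.
move=> [s1 Cs1]; set m := ereal_inf (sqdist @` C).
have mle s : C s -> m <= sqdist s by move=> Cs; apply: ereal_inf_lbound; exists s.
have m0 : 0 <= m by apply: le_ereal_inf_tmp => _ [s _ <-]; exact: sqdist_ge0.
have mfin : m \is a fin_num.
  by rewrite ge0_fin_numE// (le_lt_trans (mle _ Cs1))// sqdist_lty.
have M0 : (0 <= M)%R by apply: le_trans (f0 point) (fM point).
have /choice[s sP] : forall k : nat, exists s, C s /\ sqdist s <= m + (4^-1 ^+ k)%:E.
  move=> k; have /ereal_inf_lt[_ [s Cs <-] ms] : m < m + (4^-1 ^+ k)%:E.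
    by rewrite lteDl// lte_fin exprn_gt0.
  by exists s; split=> //; exact: ltW.
have Cs k := (sP k).1; have sm k := (sP k).2.
have ms k := mC (Cs k).
have s0 k x : (0 <= s k x)%R by have /andP[] := C0 x (Cs k).
have sf k x : (s k x <= f x)%R by have /andP[] := C0 x (Cs k).
have d2 k : \int[mu]_x ((s k x - s k.+1 x) ^+ 2)%:E <= (4 * 4^-1 ^+ k)%:E.
  have := sqdist_parallelogram (Cs k) (Cs k.+1) => par.
  have : \int[mu]_x ((s k x - s k.+1 x) ^+ 2)%:E + 4%:E * m <=
      (4 * 4^-1 ^+ k)%:E + 4%:E * m.
    apply: (@le_trans _ _ (2%:E * sqdist (s k) + 2%:E * sqdist (s k.+1))).
      by rewrite -par leeD2l// lee_wpmul2l// mle//; exact: Cmid.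
    apply: (@le_trans _ _ (2%:E * (m + (4^-1 ^+ k)%:E) + 2%:E * (m + (4^-1 ^+ k.+1)%:E))).
      by apply: leeD; apply: lee_wpmul2l.
    rewrite -(fineK mfin) -!EFinD lee_fin exprS.
    have : (0 <= 4^-1 ^+ k :> R)%R by rewrite exprn_ge0.
    by move: (4^-1 ^+ k)%R => z z0; lra.
  by rewrite leeD2rE// fin_numM.
pose K := (4 + fine (mu E))%R.
have K0 : (0 <= K)%R by rewrite addr_ge0// fine_ge0.
pose D k x : R := `|s k x - s k.+1 x|%R.
have mD k : measurable_fun setT (D k).
  by apply: measurableT_comp => //; exact: measurable_funB.
have mDe k : measurable_fun setT (fun x => (D k x)%:E) by exact/measurable_EFinP.
have D0 k x : (0 <= (D k x)%:E)%E by rewrite lee_fin normr_ge0.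
have sE k x : ~ E x -> s k x = 0%R.
  by move=> /fE fx0; apply/eqP; rewrite eq_le s0 andbT -fx0 sf.
have ID k : \int[mu]_x (D k x)%:E <= (K * 2^-1 ^+ k)%:E.
  apply: (@le_trans _ _ (\int[mu]_x ((2 ^+ k)%:E * ((s k x - s k.+1 x) ^+ 2)%:E
      + (2^-1 ^+ k)%:E * (\1_E x)%:E))).
    apply: ge0_le_integral => //.
    - apply: emeasurable_funD; apply: emeasurable_funM => //.
        by apply: measurable_sq; exact: measurable_funB.
      by apply/measurable_EFinP; exact: measurable_indic.
    (* y <= 2^k y^2 + 2^-k: this trades the L^2 bound for an L^1 bound on E. *)
    - move=> x _; rewrite -!EFinM -EFinD lee_fin /D indicE.
      have [xE|xE] := boolP (x \in E).
        rewrite mulr1 -real_normK ?num_real//.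
        move: `|_|%R (normr_ge0 (s k x - s k.+1 x)%R) => z z0.
        have p0 : (0 < 2^-1 ^+ k :> R)%R by rewrite exprn_gt0.
        rewrite -[(2 ^+ k)%R]invrK -exprVn.
        move: (_ ^+ k)%R p0 => p p0.
        rewrite -(ler_pM2l p0) mulrDr mulrA mulfV ?gt_eqF// mul1r.
        by have := sqr_ge0 (z - p)%R; have := sqr_ge0 (z + p)%R; nra.
      have nE : ~ E x by move=> /mem_set; rewrite (negbTE xE).
      by rewrite !sE// subrr normr0 expr0n/= !mulr0 addr0.
  have mI : measurable_fun setT (fun x => (\1_E x)%:E : \bar R).
    by apply/measurable_EFinP; exact: measurable_indic.
  have msq : measurable_fun setT (fun x => ((s k x - s k.+1 x) ^+ 2)%:E).
    by apply: measurable_sq; exact: measurable_funB.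
  rewrite ge0_integralD//; try by [exact: emeasurable_funM|
    move=> x _; rewrite -EFinM lee_fin; apply: mulr_ge0; rewrite ?sqr_ge0// exprn_ge0].
  rewrite !ge0_integralZl//; try by [rewrite lee_fin exprn_ge0|
    move=> x _; rewrite lee_fin sqr_ge0].
  rewrite integral_indic// setIT.
  apply: (@le_trans _ _ ((2 ^+ k)%:E * (4 * 4^-1 ^+ k)%:E + (2^-1 ^+ k)%:E * mu E)).
    by rewrite leeD2r// lee_wpmul2l// lee_fin exprn_ge0.
  have muEf : mu E \is a fin_num by rewrite ge0_fin_numE.
  rewrite -(fineK muEf) -!EFinM -EFinD lee_fin /K.
  have -> : (2 ^+ k * (4 * 4^-1 ^+ k) = 4 * 2^-1 ^+ k :> R)%R.
    by rewrite mulrCA -exprMn; congr (_ * _ ^+ _)%R; field.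
  by rewrite le_eqVlt; apply/orP; left; apply/eqP; ring.
have lbs x : has_lbound (range (s ^~ x)) by exists 0%R => _ [k _ <-].
have ubI x : has_ubound (range (infs (s ^~ x))).
  exists (f x) => _ [k _ <-]; apply: le_trans (sf k x).
  by apply: ge_inf; [exact: has_lbound_sdrop|exists k => //=].
pose l x := sup (range (infs (s ^~ x))).
have Cl : C l by exact: Climinf.
exists l => // t Ct; apply: (@le_trans _ _ m); last exact: mle.
pose S k x := \sum_(0 <= j <oo) (D (k + j)%N x)%:E.
have mS k : measurable_fun setT (S k) by apply: ge0_emeasurable_sum => // j _ _.
have S0 k x : 0 <= S k x by apply: nneseries_ge0.
have IS k : \int[mu]_x S k x <= (2 * K * 2^-1 ^+ k)%:E.
  rewrite integral_nneseries//.
  apply: le_trans (epsilon_trick0 xpredT (_ : 0 <= 2 * K * 2^-1 ^+ k)%R); last first.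
    by rewrite !mulr_ge0// exprn_ge0.
  apply: lee_nneseries => [j _ _|j _]; first by apply: integral_ge0.
  apply: le_trans (ID _) _; rewrite lee_fin exprD natrX exprS invfM -exprVn.
  rewrite le_eqVlt; apply/orP; left; apply/eqP.
  by move: (_ ^+ k)%R (_ ^+ j)%R => a b; field.
have dS k x : ((s k x - infs (s ^~ x) k)%R)%:E <= S k x.
  have partial j : ((s k x - s (k + j)%N x)%R)%:E <= S k x.
    apply: (@le_trans _ _ (\sum_(0 <= i < j) (D (k + i)%N x)%:E)); last first.
      by apply: nneseries_lim_ge.
    rewrite sumEFin lee_fin.
    elim: j => [|j IH]; first by rewrite addn0 subrr big_geq.
    rewrite big_nat_recr//= addnS.
    rewrite (_ : s k x - _ = (s k x - s (k + j)%N x) + (s (k + j)%N x - s (k + j).+1 x))%R.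
      by apply: lerD => //; exact: ler_norm.
    by ring.
  have := S0 k x; case: (S k x) partial => [r| |] partial // _; last exact: leey.
  rewrite lee_fin lerBlDl addrC -lerBlDl; apply: lb_le_inf; first by exists (s k x), k => //=.
  move=> _ [j /= kj <-]; have := partial (j - k)%N; rewrite subnKC// lee_fin.
  by lra.
(* With a = f - s k, b = s k - I k and a + b <= M, the square of a + b is at
   most a^2 + 3 M b. *)
have step k : sqdist l <= m + ((1 + 6 * M * K) * 2^-1 ^+ k)%:E.
  apply: (@le_trans _ _ (\int[mu]_x (((f x - s k x) ^+ 2)%:E + (3 * M)%:E * S k x))).
    apply: ge0_le_integral => //.
    - by move=> x _; rewrite lee_fin sqr_ge0.
    - by apply: measurable_sqdist; exact: mC.
    - apply: emeasurable_funD; first by apply: measurable_sqdist; exact: ms.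
      exact: emeasurable_funM.
    - move=> x _; apply: (@le_trans _ _ (((f x - s k x) ^+ 2)%:E + (3 * M)%:E *
          (s k x - infs (s ^~ x) k)%:E)); last first.
        by rewrite leeD2l// lee_wpmul2l// lee_fin mulr_ge0.
      rewrite -EFinM -EFinD lee_fin.
      have Il : (infs (s ^~ x) k <= l x)%R by apply: ub_le_sup => //; exists k.
      have Is : (infs (s ^~ x) k <= s k x)%R.
        by apply: ge_inf; [exact: has_lbound_sdrop|exists k => //=].
      have I0 : (0 <= infs (s ^~ x) k)%R.
        by apply: lb_le_inf; [exists (s k x), k => //=|move=> _ [j _ <-]].
      have /andP[l0 lf] := C0 x Cl.
      have := sf k x; have := fM x; move: (infs _ _) Il Is I0 => I Il Is I0 fxM skf.
      apply: (@le_trans _ _ ((f x - I) ^+ 2)%R).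
        by rewrite ler_sqr ?nnegrE; lra.
      have -> : ((f x - I) ^+ 2 = (f x - s k x) ^+ 2 +
          (2 * (f x - s k x) + (s k x - I)) * (s k x - I))%R.
        by ring.
      rewrite lerD2l; apply: ler_wpM2r; first lra.
      by have := s0 k x; lra.
  rewrite ge0_integralD//; try by [exact: emeasurable_funM|
    apply: measurable_sqdist; exact: ms|move=> x _; rewrite lee_fin sqr_ge0|
    move=> x _; rewrite mule_ge0// lee_fin mulr_ge0].
  rewrite ge0_integralZl// ?lee_fin ?mulr_ge0//.
  apply: (@le_trans _ _ ((m + (4^-1 ^+ k)%:E) + (3 * M)%:E * (2 * K * 2^-1 ^+ k)%:E)).
    apply: leeD; first exact: sm.
    by apply: lee_wpmul2l => //; rewrite lee_fin mulr_ge0.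
  rewrite -addeA leeD2l// -EFinM -EFinD lee_fin.
  have : (4^-1 ^+ k <= 2^-1 ^+ k :> R)%R by apply: lerXn2r; rewrite ?nnegrE//; lra.
  by move: (4^-1 ^+ k)%R (2^-1 ^+ k)%R => a b; lra.
apply/lee_addgt0Pr => e e0.
have c0 : (0 < 1 + 6 * M * K)%R by rewrite ltr_pwDl// !mulr_ge0.
have [k kP] : exists k : nat, ((1 + 6 * M * K) / e < k%:R)%R.
  by exists (Num.truncn ((1 + 6 * M * K) / e)).+1; rewrite truncnS_gt.
apply: le_trans (step k) _; rewrite leeD2l// lee_fin exprVn.
rewrite ler_pdivrMr ?exprn_gt0// -ler_pdivrMl// [leLHS]mulrC.
apply: (le_trans (ltW kP)); rewrite -natrX ler_nat; exact/ltnW/ltn_expl.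
Qed.

Lemma sqdist_pairing_fin (s0 : T -> R) : C s0 ->
  \int[mu]_x ((f x - s0 x) * s0 x)%:E \is a fin_num.
Proof.
move=> Cs0; have ms0 := mC Cs0.
have s00 x : (0 <= s0 x)%R by have /andP[] := C0 x Cs0.
have s0f x : (s0 x <= f x)%R by have /andP[] := C0 x Cs0.
have pair0 x : 0 <= ((f x - s0 x) * s0 x)%:E.
  by rewrite lee_fin mulr_ge0 ?subr_ge0.
have mI : measurable_fun setT (fun x => (\1_E x)%:E : \bar R).
  by apply/measurable_EFinP; exact: measurable_indic.
rewrite ge0_fin_numE; last by apply: integral_ge0 => x _; exact: pair0.
apply: (@le_lt_trans _ _ (\int[mu]_x ((M ^+ 2)%:E * (\1_E x)%:E))).
  apply: ge0_le_integral => //.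
  - apply/measurable_EFinP; apply: measurable_funM => //; exact: measurable_funB.
  - exact: emeasurable_funM.
  - move=> x _; rewrite -EFinM lee_fin indicE.
    have [xE|xE] := boolP (x \in E); last first.
      have nE : ~ E x by move=> /mem_set; rewrite (negbTE xE).
      by have := s00 x; have := s0f x; rewrite fE// => ? ?; rewrite mulr0; nra.
    by have := s00 x; have := s0f x; have := fM x; rewrite /= => ? ? ?; nra.
rewrite ge0_integralZl ?lee_fin ?sqr_ge0//.
by rewrite integral_indic// setIT lte_mul_pinfty// lee_fin sqr_ge0.
Qed.

(** First-order condition at the minimizer s0, along the segment from s0 to s.
    The segment is truncated by f to remain in C; the truncation brings
    the points closer to f.  After division by 2 t, the bound t^2 (L + M)^2 mu E
    of the second order term tends to 0 with t. *)
Lemma sqdist_variational (s0 s : T -> R) (L : R) :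
  C s0 -> (forall t, C t -> sqdist s0 <= sqdist t) ->
  measurable_fun setT s -> (forall x, 0 <= s x <= L)%R -> (forall x, ~ E x -> s x = 0%R) ->
  (forall t : R, (0 < t <= 1)%R ->
    C (fun x => Num.min ((1 - t) * s0 x + t * s x) (f x))%R) ->
  \int[mu]_x ((f x - s0 x) * s x)%:E <= \int[mu]_x ((f x - s0 x) * s0 x)%:E.
Proof.
move=> Cs0 min0 ms sL sE Cseg; have ms0 := mC Cs0.
have s00 x : (0 <= s0 x)%R by have /andP[] := C0 x Cs0.
have s0f x : (s0 x <= f x)%R by have /andP[] := C0 x Cs0.
have s0E x : ~ E x -> s0 x = 0%R.
  by move=> /fE fx0; apply/eqP; rewrite eq_le s00 andbT -fx0 s0f.
have M0 : (0 <= M)%R by apply: le_trans (f0 point) (fM point).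
have L0 : (0 <= L)%R by have /andP[a b] := sL point; exact: le_trans b.
have mphi : measurable_fun setT (fun x => f x - s0 x)%R by exact: measurable_funB.
have mpair h : measurable_fun setT h ->
    measurable_fun setT (fun x => ((f x - s0 x) * h x)%:E).
  by move=> mh; apply/measurable_EFinP; exact: measurable_funM.
have pair0 h : (forall x, 0 <= h x)%R -> forall x, 0 <= ((f x - s0 x) * h x)%:E.
  by move=> h0 x; rewrite lee_fin mulr_ge0 ?subr_ge0.
have s_0 x : (0 <= s x)%R by have /andP[] := sL x.
have mI : measurable_fun setT (fun x => (\1_E x)%:E : \bar R).
  by apply/measurable_EFinP; exact: measurable_indic.
pose c := ((L + M) ^+ 2 * fine (mu E))%R.
have c0 : (0 <= c)%R by rewrite mulr_ge0 ?sqr_ge0// fine_ge0.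
have muEf : mu E \is a fin_num by rewrite ge0_fin_numE.
have key (t : R) : (0 < t <= 1)%R ->
    (2 * t)%:E * \int[mu]_x ((f x - s0 x) * s x)%:E <=
    (2 * t)%:E * \int[mu]_x ((f x - s0 x) * s0 x)%:E + (t ^+ 2 * c)%:E.
  move=> t01; have /andP[t0 t1] := t01; have Cr := Cseg t t01.
  set r := (fun x => _) in Cr; have mr := mC Cr.
  have J0 : sqdist s0 \is a fin_num by rewrite ge0_fin_numE ?sqdist_ge0// sqdist_lty.
  rewrite -(@leeD2lE _ (sqdist s0))//.
  apply: (@le_trans _ _ (sqdist r + (2 * t)%:E * \int[mu]_x ((f x - s0 x) * s x)%:E)).
    by rewrite leeD2r// min0.
  have t20 : (0 <= 2 * t)%R by rewrite mulr_ge0// ltW.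
  rewrite -!ge0_integralZl ?lee_fin//; try by [exact: mpair|move=> x _; exact: pair0].
  have msum h : measurable_fun setT h ->
      measurable_fun setT (fun x => (2 * t)%:E * ((f x - s0 x) * h x)%:E).
    by move=> mh; apply: emeasurable_funM => //; exact: mpair.
  have sum0 h : (forall x, 0 <= h x)%R -> forall x, 0 <= (2 * t)%:E * ((f x - s0 x) * h x)%:E.
    by move=> h0 x; rewrite mule_ge0 ?lee_fin// -lee_fin; exact: pair0.
  rewrite /sqdist -ge0_integralD//; try by [exact: measurable_sqdist|exact: msum|
    move=> x _; rewrite lee_fin sqr_ge0|move=> x _; exact: sum0].
  have tLM0 : 0 <= (t ^+ 2 * (L + M) ^+ 2)%:E.
    by rewrite lee_fin; apply: mulr_ge0; exact: sqr_ge0.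
  have -> : (t ^+ 2 * c)%:E = \int[mu]_x ((t ^+ 2 * (L + M) ^+ 2)%:E * (\1_E x)%:E).
    rewrite ge0_integralZl//.
    by rewrite integral_indic// setIT -(fineK muEf) -EFinM /c mulrA.
  have mc : measurable_fun setT (fun x => (t ^+ 2 * (L + M) ^+ 2)%:E * (\1_E x)%:E).
    exact: emeasurable_funM.
  have cI0 x : 0 <= (t ^+ 2 * (L + M) ^+ 2)%:E * (\1_E x)%:E.
    by rewrite mule_ge0// lee_fin.
  rewrite addeA -ge0_integralD//; try by [exact: measurable_sqdist|exact: msum|
    move=> x _; rewrite lee_fin sqr_ge0|move=> x _; exact: sum0].
  have m1 : measurable_fun setT (fun x => ((f x - s0 x) ^+ 2)%:E +
      (2 * t)%:E * ((f x - s0 x) * s0 x)%:E).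
    by apply: emeasurable_funD; [exact: measurable_sqdist|exact: msum].
  have m10 x : 0 <= ((f x - s0 x) ^+ 2)%:E + (2 * t)%:E * ((f x - s0 x) * s0 x)%:E.
    by apply: adde_ge0; [rewrite lee_fin sqr_ge0|exact: sum0].
  rewrite -ge0_integralD//; apply: ge0_le_integral => //.
  - by move=> x _; apply: adde_ge0; [rewrite lee_fin sqr_ge0|exact: sum0].
  - by apply: emeasurable_funD; [exact: measurable_sqdist|exact: msum].
  - exact: emeasurable_funD.
  - move=> x _; rewrite -!EFinM -!EFinD lee_fin indicE /r.
    have [xE|xE] := boolP (x \in E); last first.
      have nE : ~ E x by move=> /mem_set; rewrite (negbTE xE).
      by rewrite sE// s0E// fE// !(mulr0, addr0) minxx.
    rewrite mulr1; have := sL x; move: (s00 x) (s0f x) (fM x).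
    move: (s x) (s0 x) (f x) => a b g b0 bg gM /andP[a0 aL].
    apply: (@le_trans _ _ ((g - ((1 - t) * b + t * a)) ^+ 2 + 2 * t * ((g - b) * a))%R).
      rewrite lerD2r; have [h|h] := leP ((1 - t) * b + t * a)%R g => //.
      by rewrite subrr expr0n sqr_ge0.
    have : (t ^+ 2 * (a - b) ^+ 2 <= t ^+ 2 * (L + M) ^+ 2)%R.
      apply: ler_wpM2l; first exact: sqr_ge0.
      rewrite -real_normK ?num_real// ler_sqr ?nnegrE ?addr_ge0//.
      by rewrite ler_norml; apply/andP; split; lra.
    by move: (t ^+ 2 * (L + M) ^+ 2)%R => z; lra.
have I0f := sqdist_pairing_fin Cs0.
apply/lee_addgt0Pr => e e0.
pose t := Num.min 1%R (e / (c + 1))%R.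
have t0 : (0 < t)%R by rewrite lt_min ltr01 divr_gt0// ltr_wpDl.
have t01 : (0 < t <= 1)%R by rewrite t0 ge_min lexx.
have tc : (t * (c + 1) <= e)%R by rewrite -ler_pdivlMr ?ltr_wpDl// ge_min lexx orbT.
rewrite -(@lee_pmul2l _ (2 * t)%:E) ?lte_fin ?mulr_gt0//.
apply: le_trans (key t t01) _; rewrite -(fineK I0f) -!EFinM -!EFinD lee_fin.
move: (fine _) => z; have : (t * (t * c) <= t * e)%R by rewrite ler_pM2l//; nra.
by rewrite expr2; nra.
Qed.

End L2_projection.

(** * Function norms and truncations *)

(** Axioms of a Banach function space that do not involve its weight, over an
    arbitrary measure space. *)
Record function_norm d (T : measurableType d) (R : realType)
    (mu : {measure set T -> \bar R}) (N : (T -> \bar R) -> \bar R) : Prop := FunctionNorm {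
  fnorm_ge0 : forall f, measurable_fun setT f -> 0 <= N f ;
  fnorm_eq0 : forall f, measurable_fun setT f ->
    (N f = 0 <-> {ae mu, forall x, f x = 0}) ;
  fnormD : forall f g, measurable_fun setT f -> measurable_fun setT g ->
    N (fun x => f x + g x) <= N f + N g ;
  fnormZ : forall (l : R) f, measurable_fun setT f ->
    N (fun x => l%:E * f x) = `|l|%:E * N f ;
  fnorm_le : forall f g, measurable_fun setT f -> measurable_fun setT g ->
    {ae mu, forall x, `|f x| <= `|g x|} -> N f <= N g ;
  fnorm_fatou : forall (h : (T -> \bar R)^nat) f,
    (forall j, measurable_fun setT (h j)) -> measurable_fun setT f ->
    {ae mu, forall x, (forall j, `|h j x| <= `|h j.+1 x|) /\
                      `|h j x| @[j --> \oo] --> `|f x|} ->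
    N (h j) @[j --> \oo] --> N f }.

Section truncation.
Context d (T : measurableType d) {R : realType}.

Lemma cvg_mine_nat (a : \bar R) : 0 <= a -> mine a k%:R%:E @[k --> \oo] --> a.
Proof.
case: a => [r| |] // r0.
  apply: cvg_near_cst; near=> k.
  rewrite min_l// lee_fin; near: k; exact: nbhs_infty_ger.
rewrite (_ : (fun k => _) = (fun k => k%:R%:E)); last first.
  by apply/funext => k; rewrite min_r// leey.
by apply/cvgeryP; exact: cvgr_idn.
Unshelve. all: by end_near. Qed.

(** Bounded functions supported in E that increase to |g| on E. *)
Definition trunc (E : set T) (g : T -> \bar R) (k : nat) (x : T) : R :=
  (fine (mine `|g x| k%:R%:E)%E * \1_E x)%R.

Variables (E : set T) (g : T -> \bar R).
Hypotheses (mE : measurable E) (mg : measurable_fun setT g).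

Lemma measurable_trunc k : measurable_fun setT (trunc E g k).
Proof.
apply: measurable_funM; last exact: measurable_indic.
apply: (measurableT_comp (@fine_measurable R _ measurableT)).
by apply: measurable_mine => //; exact: measurableT_comp.
Qed.

Lemma fine_trunc k x : (fine (mine `|g x| k%:R%:E)%E)%:E = mine `|g x| k%:R%:E.
Proof.
rewrite fineK// ge0_fin_numE; first by rewrite gt_min ltry orbT.
by rewrite le_min abse_ge0 lee_fin ler0n.
Qed.

Lemma trunc_EFin k x : (trunc E g k x)%:E = mine `|g x| k%:R%:E * (\1_E x)%:E.
Proof. by rewrite EFinM fine_trunc. Qed.

Lemma trunc_ge0 k x : (0 <= trunc E g k x)%R.
Proof.
by rewrite mulr_ge0// fine_ge0// le_min abse_ge0 lee_fin ler0n.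
Qed.

Lemma trunc_le k x : (trunc E g k x <= k%:R)%R.
Proof.
rewrite -lee_fin trunc_EFin indicE; case: (x \in E); rewrite ?mule1 ?mule0 ?lee_fin//.
by rewrite ge_min lexx orbT.
Qed.

Lemma trunc_out k x : ~ E x -> trunc E g k x = 0%R.
Proof. by move=> Ex; rewrite /trunc indicE memNset// mulr0. Qed.

Lemma le_trunc k x : (trunc E g k x)%:E <= `|g x|.
Proof.
rewrite trunc_EFin indicE; case: (x \in E); rewrite ?mule1 ?mule0 ?lee_fin//.
by rewrite ge_min lexx.
Qed.

Lemma trunc_mono x : {homo trunc E g ^~ x : j k / (j <= k)%N >-> (j <= k)%R}.
Proof.
move=> j k jk; rewrite -lee_fin !trunc_EFin; apply: lee_wpmul2r => //.
by rewrite le_min !ge_min lexx/= lee_fin ler_nat jk orbT.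
Qed.

Lemma cvg_trunc x : E x -> (trunc E g k x)%:E @[k --> \oo] --> `|g x|.
Proof.
move=> Ex; under eq_fun do rewrite trunc_EFin indicE mem_set// mule1.
exact: cvg_mine_nat.
Qed.

End truncation.

(** * Separation from the unit ball *)

Section unit_ball.
Context d (T : measurableType d) {R : realType} (mu : {measure set T -> \bar R}).
Variable N : (T -> \bar R) -> \bar R.
Hypothesis hN : function_norm mu N.

Lemma fnorm_mono f g : measurable_fun setT f -> measurable_fun setT g ->
  (forall x, `|f x| <= `|g x|) -> N f <= N g.
Proof. by move=> mf mg fg; apply: (fnorm_le hN) => //; exact: aeW. Qed.

Lemma fnorm0 : N (fun=> 0) = 0.
Proof. by apply/(fnorm_eq0 hN) => //; exact: aeW. Qed.

Section bounded.
Variables (E : set T) (f : T -> R) (M : R).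
Hypotheses (mE : measurable E) (Eoo : mu E < +oo).
Hypotheses (mf : measurable_fun setT f) (f0 : forall x, (0 <= f x)%R).
Hypotheses (fM : forall x, (f x <= M)%R) (fE : forall x, ~ E x -> f x = 0%R).

Let C : set (T -> R) := [set s : T -> R | [/\ measurable_fun setT s,
  forall x, (0 <= s x <= f x)%R & N (fun x => (s x)%:E) <= 1]].

Let mC (s : T -> R) : C s -> measurable_fun setT s. Proof. by case. Qed.

Let C0 (s : T -> R) x : C s -> (0 <= s x <= f x)%R. Proof. by case. Qed.

Let Cmid (s t : T -> R) : C s -> C t -> C (fun x => 2^-1 * (s x + t x))%R.
Proof.
move=> [ms s0 Ns] [mt t0 Nt]; split.
- by apply: measurable_funM => //; exact: measurable_funD.
- by move=> x; have := s0 x; have := t0 x; lra.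
- have ms' : measurable_fun setT (fun x => (s x)%:E) by exact/measurable_EFinP.
  have mt' : measurable_fun setT (fun x => (t x)%:E) by exact/measurable_EFinP.
  rewrite (_ : (fun x => _) = (fun x => 2^-1%:E * ((s x)%:E + (t x)%:E)))//.
  rewrite (fnormZ hN); last exact: emeasurable_funD.
  rewrite ger0_norm ?invr_ge0//.
  apply: (@le_trans _ _ (2^-1%:E * (1 + 1))); last by rewrite -EFinD -EFinM mulVf.
  rewrite lee_wpmul2l ?lee_fin ?invr_ge0//.
  by apply: le_trans (fnormD hN ms' mt') _; exact: leeD.
Qed.

Let Climinf (s : (T -> R)^nat) : (forall k, C (s k)) ->
  C (fun x => sup (range (infs (s ^~ x)))).
Proof.
move=> Cs; have ms k := mC (Cs k).
have s0 k x : (0 <= s k x)%R by have /andP[] := C0 x (Cs k).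
have sf k x : (s k x <= f x)%R by have /andP[] := C0 x (Cs k).
have lbs x : has_lbound (range (s ^~ x)) by exists 0%R => _ [k _ <-].
have ubs x : has_ubound (range (s ^~ x)) by exists (f x) => _ [k _ <-].
have I0 k x : (0 <= infs (s ^~ x) k)%R.
  by apply: lb_le_inf; [exists (s k x), k => //=|move=> _ [j _ <-]].
have Is k x : (infs (s ^~ x) k <= s k x)%R.
  by apply: ge_inf; [exact: has_lbound_sdrop|exists k => //=].
have mI k : measurable_fun setT (fun x => infs (s ^~ x) k).
  by apply: measurable_fun_infs => // x _; exact: lbs.
have cvgI x : infs (s ^~ x) k @[k --> \oo] --> sup (range (infs (s ^~ x))).
  exact: cvg_infs_sup.
have ml : measurable_fun setT (fun x => sup (range (infs (s ^~ x)))).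
  by apply: measurable_fun_cvg mI _ => x _; exact: cvgI.
have ubI x : has_ubound (range (infs (s ^~ x))).
  by exists (f x) => _ [k _ <-]; exact: le_trans (sf k x).
have l0 x : (0 <= sup (range (infs (s ^~ x))))%R.
  by apply: le_trans (I0 0%N x) _; apply: ub_le_sup => //; exists 0%N.
split => [//|x|].
  rewrite l0/=; apply: ge_sup; first by exists (infs (s ^~ x) 0%N), 0%N.
  by move=> _ [k _ <-]; exact: le_trans (sf k x).
have mIe k : measurable_fun setT (fun x => (infs (s ^~ x) k)%:E).
  exact/measurable_EFinP.
have : N (fun x => (infs (s ^~ x) k)%:E) @[k --> \oo] -->
    N (fun x => (sup (range (infs (s ^~ x))))%:E).
  apply: (fnorm_fatou hN) => //; first exact/measurable_EFinP.
  apply: aeW => x; split => [k|].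
    by rewrite !gee0_abs ?lee_fin//; apply: nondecreasing_infs.
  rewrite gee0_abs ?lee_fin//; under eq_fun do rewrite gee0_abs ?lee_fin//.
  by apply: cvg_EFin; [exact: nearW|exact: cvgI].
move=> cvN; rewrite -(cvg_lim _ cvN)//; apply: lime_le.
  by apply/cvg_ex; eexists; exact: cvN.
apply: nearW => k; case: (Cs k) => msk _; apply: le_trans.
apply: fnorm_mono => //; first exact/measurable_EFinP.
by move=> x; rewrite !gee0_abs ?lee_fin.
Qed.

Let Cseg (s0 s : T -> R) (t : R) : C s0 -> measurable_fun setT s ->
  (forall x, 0 <= s x)%R -> N (fun x => (s x)%:E) <= 1 -> (0 < t <= 1)%R ->
  C (fun x => Num.min ((1 - t) * s0 x + t * s x) (f x))%R.
Proof.
move=> [ms0 s00 Ns0] ms s_0 Ns /andP[t0 t1].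
pose r x := ((1 - t) * s0 x + t * s x)%R.
have r0 x : (0 <= r x)%R.
  by have /andP[? _] := s00 x; rewrite addr_ge0 ?mulr_ge0 ?subr_ge0// ltW.
have mr : measurable_fun setT r.
  by apply: measurable_funD; apply: measurable_funM.
have mrf : measurable_fun setT (fun x => Num.min (r x) (f x)).
  exact: measurable_minr.
split => // [x|]; first by rewrite le_min r0 f0 ge_min lexx orbT.
have ms' : measurable_fun setT (fun x => (s x)%:E) by exact/measurable_EFinP.
have ms0' : measurable_fun setT (fun x => (s0 x)%:E) by exact/measurable_EFinP.
apply: (@le_trans _ _ (N (fun x => (r x)%:E))).
  apply: fnorm_mono => [||x]; [exact/measurable_EFinP|exact/measurable_EFinP|].
  by rewrite !gee0_abs ?lee_fin ?le_min ?r0 ?f0// ge_min lexx.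
rewrite (_ : (fun x => _) =
  (fun x => (1 - t)%:E * (s0 x)%:E + t%:E * (s x)%:E))//.
apply: le_trans (fnormD hN _ _) _; [exact: emeasurable_funM..|].
rewrite !(fnormZ hN)// !ger0_norm ?subr_ge0//; last exact: ltW.
apply: (@le_trans _ _ ((1 - t)%:E * 1 + t%:E * 1)).
  by apply: leeD; apply: lee_wpmul2l; rewrite // lee_fin ?subr_ge0// ltW.
by rewrite !mule1 -EFinD subrK.
Qed.

(** The functional is the residual phi = f - s0, where s0 is the point nearest to
    f in the unit ball.  The first-order condition bounds it on the unit ball by
    its value at s0, and its value at f is larger by the integral of phi^2,
    which is positive as f is outside of the unit ball. *)
Lemma unit_ball_separation : 1 < N (fun x => (f x)%:E) ->
  exists (phi : T -> R) (c : R), [/\ measurable_fun setT phi,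
    forall x, (0 <= phi x)%R, (forall x, ~ E x -> phi x = 0%R), (0 < c)%R &
    (forall g, measurable_fun setT g -> N g <= 1 ->
      \int[mu]_x ((phi x)%:E * `|g x|) <= c%:E) /\
    c%:E < \int[mu]_x (phi x * f x)%:E].
Proof.
move=> Nf1.
have C_0 : C (fun=> 0%R) by split => // [x|]; rewrite ?lexx ?f0// fnorm0.
have [s0 Cs0 min0] := sqdist_minimizer mE Eoo mf f0 fM fE mC C0 Cmid Climinf
  (ex_intro _ _ C_0).
have [ms0 s0f Ns0] := Cs0.
pose phi x := (f x - s0 x)%R.
have mphi : measurable_fun setT phi by exact: measurable_funB.
have phi0 x : (0 <= phi x)%R by have /andP[_] := s0f x; rewrite subr_ge0.
have phiE x : ~ E x -> phi x = 0%R.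
  move=> /fE fx0; have := s0f x; rewrite /phi fx0 => s0x.
  by apply/eqP; rewrite subr_eq0 eq_sym eq_le andbC.
have mphiM h : measurable_fun setT h -> measurable_fun setT (fun x => (phi x * h x)%:E).
  by move=> mh; apply/measurable_EFinP; exact: measurable_funM.
set c0 := \int[mu]_x (phi x * s0 x)%:E.
have c00 : 0 <= c0.
  by apply: integral_ge0 => x _; rewrite lee_fin mulr_ge0//; have /andP[] := s0f x.
have bound g : measurable_fun setT g -> N g <= 1 ->
    \int[mu]_x ((phi x)%:E * `|g x|) <= c0.
  move=> mg Ng.
  have mtr k : measurable_fun setT (fun x => (trunc E g k x)%:E).
    by apply/measurable_EFinP; exact: measurable_trunc.
  have tr k : \int[mu]_x (phi x * trunc E g k x)%:E <= c0.
    apply: (sqdist_variational mE Eoo mf f0 fM fE mC C0 Cs0 min0 (L := k%:R)).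
    - exact: measurable_trunc.
    - by move=> x; rewrite trunc_ge0 trunc_le.
    - by move=> x; exact: trunc_out.
    - move=> t t01; apply: Cseg => //; first exact: measurable_trunc.
      + by move=> x; exact: trunc_ge0.
      + apply: le_trans Ng; apply: fnorm_mono => // x.
        by rewrite gee0_abs ?le_trunc// lee_fin trunc_ge0.
  pose G k x := (phi x)%:E * (trunc E g k x)%:E.
  (* The first-order condition concerns bounded functions supported in E; the
     others are reached by monotone convergence. *)
  have cvG : \int[mu]_x G k x @[k --> \oo] --> \int[mu]_x (limn (G ^~ x)).
    apply: cvg_monotone_convergence => //.
    - by move=> k; exact: mphiM (measurable_trunc mE mg k).
    - by move=> k x _; rewrite /G -EFinM lee_fin mulr_ge0// trunc_ge0.
    - move=> x _ j k jk; rewrite /G -!EFinM lee_fin ler_wpM2l//.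
      exact: trunc_mono.
  rewrite (_ : \int[mu]_x _ = \int[mu]_x (limn (G ^~ x))); last first.
    apply: eq_integral => x _; apply/esym/cvg_lim => //.
    have [Ex|Ex] := pselect (E x).
      by apply: cvgeZl => //; exact: cvg_trunc.
    by rewrite /G phiE// mul0e; under eq_fun do rewrite mul0e; exact: cvg_cst.
  rewrite -(cvg_lim _ cvG)//; apply: lime_le.
    by apply/cvg_ex; eexists; exact: cvG.
  by apply: nearW => k; exact: tr.
have If : \int[mu]_x (phi x * f x)%:E =
    c0 + \int[mu]_x ((phi x ^+ 2)%:E).
  rewrite -ge0_integralD//; first last.
  - by apply/measurable_EFinP; exact: measurable_funX.
  - by move=> x _; rewrite lee_fin sqr_ge0.
  - exact: mphiM.
  - by move=> x _; rewrite lee_fin mulr_ge0//; have /andP[] := s0f x.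
  by apply: eq_integral => x _; rewrite -EFinD; congr _%:E; rewrite /phi; ring.
have sq_gt0 : 0 < \int[mu]_x ((phi x ^+ 2)%:E).
  rewrite lt_neqAle integral_ge0 ?andbT; last by move=> x _; rewrite lee_fin sqr_ge0.
  apply/negP => /eqP/esym sq0; move: Nf1; rewrite ltNge => /negP; apply.
  apply: le_trans Ns0; apply: (fnorm_le hN); [exact/measurable_EFinP..|].
  have msq : measurable_fun setT (fun x => (phi x ^+ 2)%:E).
    by apply/measurable_EFinP; exact: measurable_funX.
  have : \int[mu]_x `|(phi x ^+ 2)%:E| = 0.
    by rewrite -[RHS]sq0; apply: eq_integral => x _; rewrite gee0_abs// lee_fin sqr_ge0.
  move/(ae_eq_integral_abs mu measurableT msq); apply: filterS => x /(_ I) [].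
  by move/eqP; rewrite sqrf_eq0 subr_eq0 => /eqP ->.
have c0f : c0 \is a fin_num by exact: (sqdist_pairing_fin mE Eoo mf fM fE mC C0 Cs0).
have [e e0 eI] : exists2 e : R, (0 < e)%R & e%:E < \int[mu]_x ((phi x ^+ 2)%:E).
  case: (\int[mu]_x _) sq_gt0 => [r| |] // r0; last by exists 1%R; rewrite ?ltry.
  exists (2^-1 * r)%R; first by rewrite mulr_gt0// invr_gt0.
  by rewrite lte_fin ltr_pdivrMl// ltr_pMl// ltr1n.
exists phi, (fine c0 + e)%R; split => //; first by rewrite ltr_wpDl// fine_ge0.
rewrite If EFinD fineK//; split; last by rewrite lteD2lE.
by move=> g mg Ng; apply: le_trans (bound g mg Ng) _; rewrite leeDl// lee_fin ltW.
Qed.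

End bounded.
End unit_ball.

(** * Associate spaces and duality *)

(** The factor y may be infinite. *)
Lemma nneseriesZr_le {R : realType} (f : nat -> \bar R) (y : \bar R) :
  (forall i, 0 <= f i) -> 0 <= y ->
  (\sum_(0 <= i <oo) f i) * y <= \sum_(0 <= i <oo) f i * y.
Proof.
move=> f0; case: y => [r r0| _|//].
  rewrite muleC -nneseriesZl//; apply: lee_nneseries => i *; first exact: mule_ge0.
  by rewrite muleC.
have [f_eq0|/existsNP[i fi]] := pselect (forall i, f i = 0).
  by rewrite eseries0// mul0e nneseries_ge0// => i _ _; rewrite f_eq0 mul0e.
have fi_gt0 : 0 < f i by rewrite lt_neqAle f0 andbT eq_sym; exact/eqP.
rewrite [leRHS](_ : _ = +oo) ?leey//; apply/eqP; rewrite -leye_eq.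
apply: le_trans (nneseries_lim_ge i.+1 _); last by move=> j *; rewrite mule_ge0.
rewrite big_nat_recr//= gt0_muley// leeDr// sume_ge0// => j _.
exact: mule_ge0.
Qed.

Section duality.
Context d (T : measurableType d) {R : realType} (mu : {measure set T -> \bar R}).
Variables (w : T -> \bar R) (N : (T -> \bar R) -> \bar R).
Hypothesis mw : measurable_fun setT w.
Hypothesis hN : function_norm mu N.

(** The norm of the associate space, over an arbitrary measure space. *)
Definition dual_norm (f : T -> \bar R) : \bar R :=
  ereal_sup [set \int[mu]_x (`|f x * g x| * w x) |
    g in [set g | measurable_fun setT g /\ N g <= 1]].

(** A weight may be negative on a null set; replacing it by its absolute value
    makes all integrands nonnegative everywhere. *)
Lemma integral_abs_weight (f : T -> \bar R) : {ae mu, forall x, 0 <= w x} ->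
  measurable_fun setT f ->
  \int[mu]_x (f x * w x) = \int[mu]_x (f x * `|w x|).
Proof.
move=> w0 mf; apply: ae_eq_integral => //.
- exact: emeasurable_funM.
- by apply: emeasurable_funM => //; exact: measurableT_comp.
- by apply: filterS w0 => x wx _; rewrite gee0_abs.
Qed.

Lemma dual_hoelder (h g : T -> \bar R) (K : R) : {ae mu, forall x, 0 <= w x} ->
  measurable_fun setT h -> measurable_fun setT g -> (0 < K)%R ->
  dual_norm h <= K%:E ->
  \int[mu]_x (`|h x * g x| * w x) <= K%:E * N g.
Proof.
move=> w0 mh mg K0 hK.
have mhg (k : T -> \bar R) : measurable_fun setT k ->
    measurable_fun setT (fun x => `|h x * k x|).
  by move=> mk; apply: measurableT_comp => //; exact: emeasurable_funM.
have mw' : measurable_fun setT (fun x => `|w x|) by exact: measurableT_comp.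
have mhgw (k : T -> \bar R) : measurable_fun setT k ->
    measurable_fun setT (fun x => `|h x * k x| * `|w x|).
  by move=> mk; apply: emeasurable_funM => //; exact: mhg.
rewrite integral_abs_weight//; last exact: mhg.
have := fnorm_ge0 hN mg; case NgE : (N g) => [r| |]// r0; last first.
  by rewrite gt0_muley ?lte_fin// leey.
move: r0; rewrite lee_fin le_eqVlt => /predU1P[r0|r0].
  rewrite -r0 mule0 (_ : \int[mu]_x _ = 0)//.
  have /(fnorm_eq0 hN mg) g0 : N g = 0 by rewrite NgE -r0.
  rewrite (ae_eq_integral (cst 0))//; first by rewrite integral0.
    exact: mhgw.
  by apply: filterS g0 => x gx _; rewrite gx mule0 abse0 mul0e.
have mrg : measurable_fun setT (fun x => r^-1%:E * g x) by exact: emeasurable_funM.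
have Nr : N (fun x => r^-1%:E * g x) <= 1.
  rewrite (fnormZ hN)// NgE ger0_norm; last by rewrite invr_ge0 ltW.
  by rewrite -EFinM mulVf// gt_eqF.
have : \int[mu]_x (`|h x * (r^-1%:E * g x)| * w x) <= K%:E.
  by apply: le_trans hK; apply: ereal_sup_ubound; exists (fun x => r^-1%:E * g x).
rewrite integral_abs_weight//; last exact: mhg.
rewrite (_ : \int[mu]_x _ = r^-1%:E * \int[mu]_x (`|h x * g x| * `|w x|)).
  by rewrite lee_pdivrMl// muleC.
rewrite -ge0_integralZl//; last 2 first.
- exact: mhgw.
- by rewrite lee_fin invr_ge0 ltW.
apply: eq_integral => x _; rewrite muleCA abseM/= muleA ger0_norm// invr_ge0.
exact: ltW.
Qed.

Hypothesis w_pos : {ae mu, forall x, 0 < w x < +oo}.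
Hypothesis sfmu : sigma_finite setT mu.
Hypothesis Nloc : forall E, measurable E -> \int[mu]_(x in E) w x < +oo ->
  exists2 c : R, (0 < c)%R & forall f, measurable_fun setT f ->
      \int[mu]_(x in E) (`|f x| * w x) <= c%:E * N f.

Let w_ge0 : {ae mu, forall x, 0 <= w x}.
Proof. by apply: filterS w_pos => x /andP[/ltW]. Qed.

(** On these sets both the weight and its inverse are bounded, so that
    functions supported in one of them may be divided by the weight. *)
Lemma weight_exhaustion : exists E : (set T)^nat, [/\
  forall k, measurable (E k) /\ mu (E k) < +oo,
  forall k x, E k x -> k.+1%:R^-1%:E <= w x <= k.+1%:R%:E,
  {homo E : j k / (j <= k)%N >-> j `<=` k} &
  {ae mu, forall x, exists k, E k x}].
Proof.
have [F [FT ndF Foo]] := (sigma_finiteP _ _).1 sfmu.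
pose I k := `[k.+1%:R^-1%:E, k.+1%:R%:E : \bar R]%classic.
exists (fun k => F k `&` w @^-1` I k); split.
- move=> k; have [mF Fk] := Foo k.
  have mwI : measurable (w @^-1` I k).
    by rewrite -[X in measurable X]setTI; apply: mw => //; exact: emeasurable_itv.
  split; first exact: measurableI.
  by apply: le_lt_trans Fk; apply: le_measure; rewrite ?inE//; exact: measurableI.
- by move=> k x [_]; rewrite /I/= in_itv.
- move=> j k jk x [Fx]; rewrite /I/= !in_itv/= => /andP[a b]; split.
    by move: Fx; apply/subsetPset/ndF.
  apply/andP; split.
    by apply: le_trans a; rewrite lee_fin lef_pV2 ?posrE// ler_nat.
  by apply: le_trans b _; rewrite lee_fin ler_nat.
- apply: filterS w_pos => x; case wE : (w x) => [r| |] /andP[r0 woo]; last 2 first.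
    by rewrite ltxx in woo.
    by [].
  rewrite lte_fin in r0.
  have [i _ Fx] : (\bigcup_i F i) x by rewrite -FT.
  pose k := maxn i (maxn (Num.truncn r) (Num.truncn r^-1)).
  exists k; split.
    by move: Fx; apply/subsetPset/ndF; rewrite leq_maxl.
  rewrite /I/= in_itv/= wE !lee_fin; apply/andP; split.
    rewrite invf_ple ?posrE//; apply/ltW.
    apply: lt_le_trans (truncnS_gt _) _; rewrite ler_nat ltnS.
    by rewrite /k !leq_max leqnn !orbT.
  apply/ltW; apply: lt_le_trans (truncnS_gt _) _; rewrite ler_nat ltnS.
  by rewrite /k !leq_max leqnn !orbT.
Qed.

(** The indicator functions of the sets E k of an exhaustion belong to the
    associate space, by the local integrability axiom.  A combination of all of
    them with small enough coefficients has norm at most 1. *)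
Lemma weak_unit : exists k : T -> \bar R, [/\ measurable_fun setT k,
  forall x, 0 <= k x < +oo, {ae mu, forall x, 0 < k x} & dual_norm k <= 1].
Proof.
have [E [/all_and2[mE Eoo] Ew _ Eae]] := weight_exhaustion.
have /choice[c cP] k : exists c : R, (0 < c)%R /\ forall f, measurable_fun setT f ->
    \int[mu]_(x in E k) (`|f x| * w x) <= c%:E * N f.
  have [|c c0 cN] := Nloc (mE k); last by exists c.
  apply: (@le_lt_trans _ _ (\int[mu]_(x in E k) k.+1%:R%:E)).
    apply: ge0_le_integral => //.
    - move=> x Ex; have /andP[a _] := Ew _ _ Ex; apply: le_trans a.
      by rewrite lee_fin invr_ge0.
    - exact: measurable_funTS.
    - by move=> x Ex; have /andP[_] := Ew _ _ Ex.
  by rewrite integral_cst// lte_mul_pinfty// ?lee_fin.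
have c0 k := (cP k).1; have cN k := (cP k).2.
pose b k : R := (1 / (2 ^ k.+1)%:R)%R.
have b0 k : (0 < b k)%R by rewrite divr_gt0// ltr0n expn_gt0.
pose a k : R := (b k / (c k + 1))%R.
have c10 k : (0 < c k + 1)%R by rewrite addr_gt0.
have a0 k : (0 < a k)%R by rewrite divr_gt0.
have ac k : (a k * (c k) <= b k)%R.
  by rewrite mulrAC ler_pdivrMr// ler_pM2l// lerDl.
have a1 k : (a k <= b k)%R.
  by rewrite ler_pdivrMr// mulrDr mulr1 lerDr mulr_ge0 ?(ltW (b0 k)) ?(ltW (c0 k)).
pose t k x : \bar R := (a k)%:E * (\1_(E k) x)%:E.
have t0 k x : 0 <= t k x by rewrite /t -EFinM lee_fin mulr_ge0// ltW.
have mt k : measurable_fun setT (t k).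
  by apply: emeasurable_funM => //; apply/measurable_EFinP; exact: measurable_indic.
pose K x := \sum_(0 <= k <oo) t k x.
have mK : measurable_fun setT K by apply: ge0_emeasurable_sum => *.
have K0 x : 0 <= K x by exact: nneseries_ge0.
exists K; split => //.
- move=> x; rewrite K0/=; apply: (@le_lt_trans _ _ 1%:E); last exact: ltry.
  apply: le_trans (epsilon_trick0 xpredT ler01).
  apply: lee_nneseries => // k _; rewrite /t -EFinM lee_fin indicE.
  by apply: le_trans (a1 k); rewrite ler_piMr ?(ltW (a0 k))//; case: (_ \in _).
- apply: filterS Eae => x [k Ek].
  apply: lt_le_trans (nneseries_lim_ge k.+1 _) => [|//].
  rewrite big_nat_recr//= (@lt_le_trans _ _ (t k x))//.
    by rewrite /t indicE mem_set// mule1 lte_fin.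
  by rewrite leeDr// sume_ge0.
apply: ge_ereal_sup => _ [g [mg Ng] <-].
have mg' : measurable_fun setT (fun x => `|g x|) by exact: measurableT_comp.
have mw' : measurable_fun setT (fun x => `|w x|) by exact: measurableT_comp.
have mgw : measurable_fun setT (fun x => `|g x| * `|w x|) by exact: emeasurable_funM.
have mtgw k : measurable_fun setT (fun x => t k x * (`|g x| * `|w x|)).
  exact: emeasurable_funM.
rewrite integral_abs_weight//; last first.
  by apply: measurableT_comp => //; exact: emeasurable_funM.
apply: (@le_trans _ _ (\int[mu]_x \sum_(0 <= k <oo) (t k x * (`|g x| * `|w x|)))).
  apply: ge0_le_integral => //.
  - by apply: emeasurable_funM => //; apply: measurableT_comp => //; exact: emeasurable_funM.
  - apply: ge0_emeasurable_sum => // k x _ _.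
    by apply: mule_ge0 => //; exact: mule_ge0.
  - move=> x _; rewrite abseM (gee0_abs (K0 x)) -muleA.
    by apply: nneseriesZr_le => //; rewrite mule_ge0.
rewrite integral_nneseries//; last by move=> k x _; apply: mule_ge0 => //; exact: mule_ge0.
apply: le_trans (epsilon_trick0 xpredT ler01).
apply: lee_nneseries => [k _ _|k _].
  by apply: integral_ge0 => x _; apply: mule_ge0 => //; exact: mule_ge0.
apply: (@le_trans _ _ ((a k)%:E * \int[mu]_(x in E k) (`|g x| * w x))).
  rewrite (_ : \int[mu]_(x in E k) _ =
    \int[mu]_x ((\1_(E k) x)%:E * (`|g x| * `|w x|))).
    have mI : measurable_fun setT (fun x => (\1_(E k) x)%:E * (`|g x| * `|w x|)).
      by apply: emeasurable_funM => //; apply/measurable_EFinP; exact: measurable_indic.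
    have I0 x : 0 <= (\1_(E k) x)%:E * (`|g x| * `|w x|).
      by apply: mule_ge0; [rewrite lee_fin|exact: mule_ge0].
    rewrite -ge0_integralZl//; last by rewrite lee_fin ltW.
    apply: ge0_le_integral => //.
    - by move=> x _; apply: mule_ge0 => //; exact: mule_ge0.
    - exact: emeasurable_funM.
    - by move=> x _; rewrite /t [leRHS]muleA.
  rewrite integral_mkcond; apply: eq_integral => x _; rewrite epatch_indic/= muleC.
  rewrite indicE; have [xE|] := boolP (x \in E k); last by rewrite !mul0e.
  rewrite !mul1e [`|w x|]gee0_abs//; move: xE; rewrite inE => /Ew/andP[+ _].
  by apply: le_trans; rewrite lee_fin.
apply: (@le_trans _ _ ((a k)%:E * ((c k)%:E * 1))).
  apply: lee_wpmul2l; first by rewrite lee_fin ltW.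
  apply: le_trans (cN k g mg) _; apply: lee_wpmul2l => //.
  by rewrite lee_fin ltW.
by rewrite mule1 -EFinM lee_fin.
Qed.

Lemma dual_normD (h k : T -> \bar R) : measurable_fun setT h -> measurable_fun setT k ->
  (forall x, 0 <= h x) -> (forall x, 0 <= k x) ->
  dual_norm (fun x => h x + k x) <= dual_norm h + dual_norm k.
Proof.
move=> mh mk h0 k0; apply: ge_ereal_sup => _ [g [mg Ng] <-].
have mg' : measurable_fun setT (fun x => `|g x|) by exact: measurableT_comp.
have mw' : measurable_fun setT (fun x => `|w x|) by exact: measurableT_comp.
have mabs (f : T -> \bar R) : measurable_fun setT f ->
    measurable_fun setT (fun x => `|f x * g x|).
  by move=> mf; apply: measurableT_comp => //; exact: emeasurable_funM.
have mM (f : T -> \bar R) : measurable_fun setT f ->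
    measurable_fun setT (fun x => `|f x * g x| * `|w x|).
  by move=> mf; apply: emeasurable_funM => //; exact: mabs.
rewrite integral_abs_weight//; last by apply: mabs; exact: emeasurable_funD.
rewrite (_ : \int[mu]_x _ = \int[mu]_x (`|h x * g x| * w x) + \int[mu]_x (`|k x * g x| * w x)).
  by apply: leeD; apply: ereal_sup_ubound; exists g.
rewrite !(integral_abs_weight w_ge0); [|exact: mabs..].
rewrite -ge0_integralD//; [|exact: mM..].
apply: eq_integral => x _; rewrite !abseM (gee0_abs (h0 x)) (gee0_abs (k0 x)).
rewrite (gee0_abs (adde_ge0 (h0 x) (k0 x))).
by rewrite ge0_muleDl// ge0_muleDl//; exact: mule_ge0.
Qed.

(** A norm is recovered from the associate norm, with test functions h that are
    finite everywhere and positive almost everywhere.  If N F > K' > K, some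
    truncation of F / K' has norm larger than 1; a functional phi separates it
    from the unit ball, h0 = phi / (c w) has associate norm at most 1 and its
    pairing with F exceeds K'.  Adding the weak unit u makes h0 positive, at the
    price of a norm at most 2 instead of 1. *)
Lemma lorentz_luxemburg (F : T -> \bar R) (K : \bar R) :
  measurable_fun setT F -> 0 <= K ->
  (forall h : T -> \bar R, measurable_fun setT h -> (forall x, 0 <= h x < +oo) ->
    {ae mu, forall x, 0 < h x} -> dual_norm h <= 2%:E ->
    \int[mu]_x (`|F x| * (h x * w x)) <= K) ->
  N F <= K.
Proof.
move=> mF; case: K => [K| |] K0 test; [|exact: leey|by []].
rewrite lee_fin in K0; apply/lee_addgt0Pr => e e0.
set K' := (K + e)%R; have K'0 : (0 < K')%R by rewrite ltr_wpDl.
rewrite -EFinD -/K' leNgt; apply/negP => NF.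
have [E [/all_and2[mE Eoo] Ew ndE Eae]] := weight_exhaustion.
pose G x := K'^-1%:E * F x.
have mG : measurable_fun setT G by exact: emeasurable_funM.
have NG : 1 < N G.
  rewrite /G (fnormZ hN)// ger0_norm ?invr_ge0 ?(ltW K'0)//.
  by rewrite lte_pdivlMl// mule1.
have mtr k : measurable_fun setT (trunc (E k) G k) by exact: measurable_trunc.
have mtr' k : measurable_fun setT (fun x => (trunc (E k) G k x)%:E).
  by apply/measurable_EFinP; exact: mtr.
have [k Nk] : exists k, 1 < N (fun x => (trunc (E k) G k x)%:E).
  apply: contrapT => /forallNP Nle; move: NG; rewrite ltNge => /negP; apply.
  have cvN : N (fun x => (trunc (E k) G k x)%:E) @[k --> \oo] --> N G.
    apply: (fnorm_fatou hN) => //; apply: filterS Eae => x [k0 Ek0].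
    have Ek k : (k0 <= k)%N -> E k x by move=> kk; exact: ndE kk _ Ek0.
    split => [j|].
      rewrite !gee0_abs ?lee_fin ?trunc_ge0// -lee_fin !trunc_EFin.
      apply: lee_pmul.
      - by rewrite le_min abse_ge0 lee_fin ler0n.
      - by rewrite lee_fin.
      - by rewrite le_min !ge_min lexx/= lee_fin ler_nat leqnSn orbT.
      rewrite lee_fin !indicE ler_nat; have [/set_mem Ejx|//] := boolP (x \in E j).
      by rewrite mem_set//; apply: (ndE j).
    rewrite (_ : (fun _ => _) = (fun j => (trunc (E j) G j x)%:E)); last first.
      by apply/funext => j; rewrite gee0_abs ?lee_fin ?trunc_ge0.
    apply: cvg_trans (cvg_mine_nat (abse_ge0 (G x))); apply: near_eq_cvg.
    near=> j; rewrite trunc_EFin indicE mem_set ?mule1//.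
    by apply: Ek; near: j; exact: nbhs_infty_ge.
  rewrite -(cvg_lim _ cvN)//; apply: lime_le.
    by apply/cvg_ex; eexists; exact: cvN.
  by apply: nearW => j; rewrite leNgt; apply/negP; exact: Nle.
have [phi [c [mphi phi0 phiE c0 [phib phif]]]] := unit_ball_separation hN (mE k) (Eoo k)
  (mtr k) (trunc_ge0 (E k) G k) (trunc_le (E k) G k) (trunc_out (E := E k) G k) Nk.
have [u [m_u u0 upos Nu]] := weak_unit.
(* On E k, where w is positive and finite, this is phi / (c w); outside of E k
   it vanishes with phi. *)
pose h0 x : \bar R := (phi x * (c * fine (w x)) `^ (-1))%:E.
have wE x : E k x -> exists2 r : R, (0 < r)%R & w x = r%:E.
  move=> /Ew; case: (w x) => [r| |] /andP[]//.
  rewrite !lee_fin => r0 _; exists r => //; apply: lt_le_trans r0.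
  by rewrite invr_gt0.
have mh0 : measurable_fun setT h0.
  apply/measurable_EFinP; apply: measurable_funM => //.
  apply: (measurableT_comp (measurable_powR (-1))).
  apply: measurable_funM => //.
  exact: (measurableT_comp (@fine_measurable R _ measurableT)).
have h00 x : 0 <= h0 x.
  rewrite lee_fin; have [Ex|Ex] := pselect (E k x); last by rewrite phiE// mul0r.
  by rewrite mulr_ge0// powR_ge0.
have h0w x (y : \bar R) : 0 <= y -> h0 x * y * w x = c^-1%:E * ((phi x)%:E * y).
  move=> y0; rewrite /h0; have [Ex|Ex] := pselect (E k x); last first.
    by rewrite phiE// mul0r !mul0e mule0.
  have [r r0 ->] := wE x Ex; rewrite /= powR_inv1; last first.
    by rewrite mulr_ge0 ?(ltW c0) ?(ltW r0).
  rewrite muleAC -EFinM muleA -EFinM.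
  by congr (_%:E * _); field; rewrite !gt_eqF.
have Nh0 : dual_norm h0 <= 1.
  apply: ge_ereal_sup => _ [g [mg Ng] <-].
  rewrite (_ : \int[mu]_x _ = c^-1%:E * \int[mu]_x ((phi x)%:E * `|g x|)).
    by rewrite lee_pdivrMl// mule1; exact: phib.
  rewrite -ge0_integralZl//.
  - by apply: eq_integral => x _; rewrite abseM gee0_abs// h0w.
  - apply: emeasurable_funM; [exact/measurable_EFinP|exact: measurableT_comp].
  - by move=> x _; rewrite mule_ge0// lee_fin.
  - by rewrite lee_fin invr_ge0 ltW.
have mh : measurable_fun setT (fun x => h0 x + u x) by exact: emeasurable_funD.
have u0' x : 0 <= u x by have /andP[] := u0 x.
have h1 x : 0 <= h0 x + u x < +oo.
  rewrite adde_ge0//= lte_add_pinfty// ?ltry//.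
  by have /andP[] := u0 x.
have h2 : {ae mu, forall x, 0 < h0 x + u x}.
  by apply: filterS upos => x ux; rewrite (lt_le_trans ux)// leeDr.
have h3 : dual_norm (fun x => h0 x + u x) <= 2%:E.
  apply: le_trans (dual_normD mh0 m_u h00 u0') _.
  by apply: (@le_trans _ _ (1 + 1)); [exact: leeD|rewrite -EFinD].
have := test _ mh h1 h2 h3; apply/negP; rewrite -ltNge.
have mF' : measurable_fun setT (fun x => `|F x|) by exact: measurableT_comp.
have mw' : measurable_fun setT (fun x => `|w x|) by exact: measurableT_comp.
apply: (@lt_le_trans _ _ (K'%:E)); first by rewrite lte_fin ltrDl.
rewrite [leRHS](_ : _ = \int[mu]_x (`|F x| * (h0 x + u x) * `|w x|)); last first.
  rewrite -integral_abs_weight//; last exact: emeasurable_funM.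
  by apply: eq_integral => x _; rewrite muleA.
apply: (@le_trans _ _ (\int[mu]_x ((K' * c^-1)%:E * ((phi x)%:E * `|G x|)))); last first.
  apply: ge0_le_integral => //.
  - by move=> x _; rewrite !mule_ge0// lee_fin// divr_ge0// ltW.
  - apply: emeasurable_funM => //; apply: emeasurable_funM => //.
      exact/measurable_EFinP.
    exact: measurableT_comp.
  - by apply: emeasurable_funM => //; exact: emeasurable_funM.
  - move=> x _; rewrite EFinM -muleA -h0w//.
    rewrite /G abseM/= ger0_norm ?invr_ge0 ?(ltW K'0)//.
    rewrite (muleCA (h0 x)) -muleA muleA -EFinM mulfV ?gt_eqF// mul1e.
    rewrite (muleC (h0 x)); have [Ex|Ex] := pselect (E k x); last first.
      rewrite /h0 phiE// mul0r mule0 mul0e add0e.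
      by rewrite !mule_ge0.
    have [r r0 ->] := wE x Ex; have r0' : 0 <= r%:E by rewrite lee_fin ltW.
    rewrite (gee0_abs r0').
    apply: lee_wpmul2r => //.
    by apply: lee_wpmul2l => //; rewrite leeDl.
have mpG : measurable_fun setT (fun x => (phi x)%:E * `|G x|).
  by apply: emeasurable_funM; [exact/measurable_EFinP|exact: measurableT_comp].
rewrite ge0_integralZl//; [|by move=> x _; rewrite mule_ge0// lee_fin|
  by rewrite lee_fin divr_ge0// ltW].
rewrite EFinM -muleA -[leLHS]mule1; apply: lee_wpmul2l; first by rewrite lee_fin ltW.
rewrite lee_pdivlMl// mule1; apply: le_trans (ltW phif) _.
apply: ge0_le_integral => //.
- by move=> x _; rewrite lee_fin mulr_ge0// trunc_ge0.
- by apply/measurable_EFinP; exact: measurable_funM.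
- by move=> x _; rewrite EFinM lee_wpmul2l ?lee_fin// le_trunc.
Unshelve. all: by end_near. Qed.

End duality.

(** * Banach function spaces and dual maximal operators *)

Section banach_function_space.
Context {R : realType} {n : nat}.
Implicit Types (v V G w h : euclid R n -> \bar R) (Y Z : (euclid R n -> \bar R) -> \bar R).

Lemma bfs_function_norm v Y : is_bfs v Y -> function_norm leb Y.
Proof.
move=> hY; split.
- exact: bfs_ge0 hY.
- exact: bfs_eq0 hY.
- exact: bfs_triangle hY.
- exact: bfs_scale hY.
- exact: bfs_le hY.
- by move=> h f mh mf hf; have [] := bfs_fatou hY mh mf hf.
Qed.

(** Duality in the source space Y reduces the norm of G1 to integrals against
    test functions h; each of them is dominated by a pairing of G2 with a
    function H controlled in the associate space of Z. *)
Lemma bfs_transfer v V Y Z G1 G2 (C K : R) : weight v -> is_bfs v Y ->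
  measurable_fun setT V -> {ae leb, forall x, 0 <= V x} -> is_bfs V Z ->
  measurable_fun setT G1 -> measurable_fun setT G2 -> (0 < C)%R -> (0 < K)%R ->
  (forall h, measurable_fun setT h -> (forall x, 0 <= h x < +oo) ->
    {ae leb, forall x, 0 < h x} -> associate v Y h <= 2%:E ->
    exists H, [/\ measurable_fun setT H, associate V Z H <= K%:E &
      \int[leb]_x (`|G1 x| * (h x * v x)) <=
      C%:E * \int[leb]_x (`|H x * G2 x| * V x)]) ->
  Y G1 <= (C * K)%:E * Z G2.
Proof.
move=> [mv v0] hY mV V0 hZ mG1 mG2 C0 K0 tr.
have fY := bfs_function_norm hY; have fZ := bfs_function_norm hZ.
apply: (lorentz_luxemburg mv fY v0 sigma_finite_leb _ mG1).
- by move=> E mE Ev; have [_ ?] := bfs_indic hY mE Ev.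
- by rewrite mule_ge0 ?lee_fin ?mulr_ge0 ?(ltW C0) ?(ltW K0)//; exact: fnorm_ge0 fZ _ mG2.
move=> h mh h0 hpos hN; have [H [mH HK Hle]] := tr h mh h0 hpos hN.
apply: (le_trans Hle); rewrite EFinM -muleA; apply: lee_wpmul2l.
  by rewrite lee_fin ltW.
exact: (dual_hoelder mV fZ V0 mH mG2 K0 HK).
Qed.

Lemma maximal_abse (Phi : R -> R) G1 G2 : (forall x, `|G1 x| = `|G2 x|) ->
  maximal Phi G1 = maximal Phi G2.
Proof.
move=> G12; apply/funext => x; congr ereal_sup; apply/seteqP.
have E Q : luxemburg Phi Q G1 = luxemburg Phi Q G2.
  rewrite /luxemburg; congr ereal_inf; congr image; apply/funext => l; congr and.
  by apply/propext; under eq_integral do rewrite G12.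
by split => _ [Q Qx <-]; exists Q => //; rewrite E.
Qed.

Lemma leb_complete : measure_is_complete (leb : set (euclid R n) -> \bar R).
Proof. exact: measure_is_complete_caratheodory. Qed.

Lemma weight_poweR (u : euclid R n -> \bar R) (p : R) : weight u ->
  weight (fun x => u x `^ p).
Proof.
move=> [mu u0]; split; first exact: (measurableT_comp (measurable_poweR p) mu).
by apply: filterS u0 => x /andP[a b]; rewrite poweR_gt0//= poweR_lty.
Qed.

(** By completeness of Lebesgue measure it is enough to consider the points
    where the weight is positive and finite. *)
Lemma measurable_dual_maximal (B : R -> R) w h : weight w ->
  measurable_fun setT (dual_maximal B w h).
Proof.
move=> [mw w0].
apply: (ae_measurable_fun leb_complete
  (f := fun x => maximal B (fun y => h y * w y) x * (fine (w x) `^ (-1))%:E)).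
  apply: filterS w0 => x /andP[w0 woo] _; rewrite /dual_maximal gt_eqF//.
  congr (_ * _); case: (w x) w0 woo => [r| |]//; rewrite lte_fin => r0 _.
  by rewrite inver gt_eqF//= powR_inv1// ltW.
apply: emeasurable_funM; first exact: measurable_maximal.
apply/measurable_EFinP; apply: (measurableT_comp (measurable_powR (-1))).
exact: (measurableT_comp (@fine_measurable R _ measurableT)).
Qed.

Lemma dual_maximalK (B : R -> R) w h x : 0 < w x < +oo ->
  dual_maximal B w h x * w x = maximal B (fun y => h y * w y) x.
Proof.
move=> /andP[w0 woo]; rewrite /dual_maximal gt_eqF//.
case: (w x) w0 woo => [r| |]//; rewrite lte_fin => r0 _.
by rewrite inver gt_eqF// -muleA -EFinM mulVf ?mule1// gt_eqF.
Qed.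

Lemma dual_maximal_ge0 (B : R -> R) w h x : 0 <= w x -> 0 <= dual_maximal B w h x.
Proof.
move=> w0; rewrite /dual_maximal; case: ifP => // _.
by rewrite mule_ge0 ?inve_ge0// maximal_ge0.
Qed.

Lemma power_norm_poweR (p : R) (N : (euclid R n -> \bar R) -> \bar R) (k : euclid R n -> \bar R) :
  p != 0%R -> (forall x, 0 <= k x) ->
  power_norm p^-1 N (fun x => k x `^ p) = N k `^ p.
Proof.
move=> p0 k0; rewrite /power_norm invrK; congr (N _ `^ _); apply/funext => x.
by rewrite gee0_abs ?poweR_ge0// -poweRrM mulfV// poweRe1.
Qed.

Lemma lpnorm_le (p C : R) (w W f g : euclid R n -> \bar R) : (0 < p)%R -> (0 < C)%R ->
  (forall x, 0 <= w x) -> (forall x, 0 <= W x) ->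
  lpnorm p w f <= C%:E * lpnorm p W g ->
  \int[leb]_x (`|f x| `^ p * w x) <= (C `^ p)%:E * \int[leb]_x (`|g x| `^ p * W x).
Proof.
move=> p0 C0 w0 W0; rewrite /lpnorm.
have a0 : 0 <= \int[leb]_x (`|f x| `^ p * w x).
  by apply: integral_ge0 => x _; rewrite mule_ge0// poweR_ge0.
have b0 : 0 <= \int[leb]_x (`|g x| `^ p * W x).
  by apply: integral_ge0 => x _; rewrite mule_ge0// poweR_ge0.
move: (\int[leb]_x (`|f x| `^ p * w x)) (\int[leb]_x (`|g x| `^ p * W x)) a0 b0 => a b a0 b0 ab.
have : (a `^ p^-1) `^ p <= (C%:E * b `^ p^-1) `^ p.
  apply: (gt0_ler_poweR (ltW p0) _ _ ab).
    by rewrite in_itv/= poweR_ge0 leey.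
  by rewrite in_itv/= leey mule_ge0 ?poweR_ge0// lee_fin ltW.
rewrite poweRM ?lee_fin ?(ltW C0) ?poweR_ge0// -!poweRrM mulVf ?gt_eqF//.
by rewrite !poweRe1.
Qed.

End banach_function_space.

(** * Extrapolation *)

Section extrapolation.
Context {R : realType} {n : nat}.
Variables (Phi A B : R -> R).
Hypotheses (gPhi : gauge Phi) (gA : gauge A) (gB : gauge B).
Hypothesis hAB : young_inv_le A B Phi.

(** In the first part a = u^p, w = V = v, G1 = (f u)^p and G2 = g^p M_A (u^p);
    in the second part a = v, w = u^p, V = M_A v, G1 = (f u)^p and G2 = (g u)^p.
    For a test function h, the extrapolation hypothesis is used with a weight
    W = a h w almost everywhere, that is u^p h v in both cases. *)
Lemma extrapolation_step (v V w a : euclid R n -> \bar R)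
    (Y Z : (euclid R n -> \bar R) -> \bar R) (p C0 K0 : R) :
  weight v -> is_bfs v Y -> measurable_fun setT V -> {ae leb, forall x, 0 <= V x} ->
  is_bfs V Z -> weight w -> weight a -> (0 < p)%R -> (0 < C0)%R -> (0 < K0)%R ->
  (forall h, measurable_fun setT h ->
    associate V Z (dual_maximal B w h) <= K0%:E * associate v Y h) ->
  exists2 C : R, (0 < C)%R & forall f g G1 G2 : euclid R n -> \bar R,
    measurable_fun setT f -> measurable_fun setT g ->
    measurable_fun setT G1 -> measurable_fun setT G2 ->
    (forall x, 0 <= G1 x) -> (forall x, 0 <= G2 x) ->
    {ae leb, forall x, G1 x * v x = `|f x| `^ p * (a x * w x)} ->
    {ae leb, forall x, G2 x * V x = `|g x| `^ p * maximal A a x * w x} ->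
    (forall w0, weight w0 ->
      lpnorm p w0 f <= C0%:E * lpnorm p (maximal Phi w0) g) ->
    Y G1 <= C%:E * Z G2.
Proof.
move=> hv hY mV V0 hZ hw ha p0 C00 K00 hK.
have [c c0 hoelder] := @maximal_hoelder R n _ _ _ gPhi gA gB hAB.
have C0p : (0 < C0 `^ p)%R by rewrite powR_gt0.
exists (C0 `^ p * c * (K0 * 2))%R; first by rewrite !mulr_gt0.
move=> f g G1 G2 mf mg mG1 mG2 G10 G20 G1E G2E hext.
have [[mv v0] [mw w0] [ma a0]] := And3 hv hw ha.
have Cc0 : (0 < C0 `^ p * c)%R by rewrite mulr_gt0.
have K20 : (0 < K0 * 2)%R by rewrite mulr_gt0.
apply: (bfs_transfer hv hY mV V0 hZ mG1 mG2 Cc0 K20).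
move=> h mh h0 hpos hN; pose H := dual_maximal B w h.
have mH : measurable_fun setT H by exact: measurable_dual_maximal.
exists H; split; first exact: mH.
  apply: (le_trans (hK h mh)); rewrite EFinM; apply: lee_wpmul2l; last exact: hN.
  by rewrite lee_fin ltW.
have mabs (k : euclid R n -> \bar R) : measurable_fun setT k ->
    measurable_fun setT (fun x => `|k x|).
  by move=> mk; exact: (measurableT_comp (@abse_measurable R setT) mk).
have mpow (k : euclid R n -> \bar R) : measurable_fun setT k ->
    measurable_fun setT (fun x => `|k x| `^ p).
  by move=> mk; exact: (measurableT_comp (measurable_poweR p) (mabs _ mk)).
pose F x := `|a x|; pose G x := h x * `|w x|; pose W x := F x * G x.
have mF : measurable_fun setT F by exact: mabs.
have mG : measurable_fun setT G by apply: (emeasurable_funM mh); exact: mabs.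
have mW : measurable_fun setT W by exact: (emeasurable_funM mF mG).
have h00 x : 0 <= h x by have /andP[] := h0 x.
have G0 x : 0 <= G x by rewrite mule_ge0.
have W0 x : 0 <= W x by apply: mule_ge0; [exact: abse_ge0|exact: G0].
have Fpos : {ae leb, forall x, 0 < F x < +oo}.
  by apply: filterS a0 => x /andP[a0 aoo]; rewrite /F gee0_abs ?ltW// a0.
have Gpos : {ae leb, forall x, 0 < G x < +oo}.
  apply: filterS2 w0 hpos => x /andP[w0 woo] hx; rewrite /G gee0_abs ?(ltW w0)//.
  by rewrite mule_gt0// lte_mul_pinfty// ge0_fin_numE//; have /andP[] := h0 x.
have wW : weight W.
  split; first exact: mW.
  apply: filterS2 Fpos Gpos => x /andP[F0 Foo] /andP[G0' Goo].
  rewrite /W mule_gt0//= lte_mul_pinfty ?(ltW F0)// ge0_fin_numE//.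
  exact: ltW.
have ae0 (k : euclid R n -> \bar R) : {ae leb, forall x, 0 < k x < +oo} ->
    {ae leb, forall x, k x != 0}.
  by apply: filterS => x /andP[k0 _]; rewrite gt_eqF.
have MW x : maximal Phi W x <= c%:E * (maximal A a x * maximal B (fun y => h y * w y) x).
  rewrite (@maximal_abse _ _ A a F); last by move=> y; rewrite /F abse_id.
  rewrite (@maximal_abse _ _ B (fun y => h y * w y) G); last first.
    by move=> y; rewrite /G !abseM abse_id.
  exact: (hoelder F G mF mG (ae0 _ Fpos) (ae0 _ Gpos)).
rewrite (ae_eq_integral (fun x => `|f x| `^ p * W x) _ measurableT); last 3 first.
- by apply: (emeasurable_funM (mabs _ mG1)); exact: (emeasurable_funM mh mv).
- exact: (emeasurable_funM (mpow _ mf) mW).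
- apply: filterS3 G1E a0 w0 => x G1x /andP[a0 _] /andP[w0 _] _.
  rewrite (gee0_abs (G10 x)) muleCA G1x /W /F /G.
  rewrite (gee0_abs (ltW a0)) (gee0_abs (ltW w0)).
  by rewrite muleCA [h x * (a x * w x)]muleCA.
have le1 := lpnorm_le p0 C00 W0 (maximal_ge0 Phi W) (hext W wW).
apply: (le_trans le1); rewrite EFinM -muleA; apply: lee_wpmul2l.
  by rewrite lee_fin ltW.
have mHG2 : measurable_fun setT (fun x => `|H x * G2 x|).
  by apply: mabs; exact: (emeasurable_funM mH mG2).
rewrite (integral_abs_weight mV V0 mHG2).
have mHG : measurable_fun setT (fun x => `|H x * G2 x| * `|V x|).
  exact: (emeasurable_funM mHG2 (mabs _ mV)).
have HG0 x : 0 <= `|H x * G2 x| * `|V x| by rewrite mule_ge0.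
rewrite -ge0_integralZl; [|exact: measurableT|exact: mHG|
  by move=> x _; exact: HG0|by rewrite lee_fin ltW].
apply: ae_ge0_le_integral.
- exact: measurableT.
- by move=> x _; rewrite mule_ge0 ?poweR_ge0// maximal_ge0.
- by apply: (emeasurable_funM (mpow _ mg)); exact: measurable_maximal.
- by move=> x _; rewrite mule_ge0// lee_fin ltW.
- exact: emeasurable_funM.
- apply: filterS3 G2E w0 V0 => x G2x wx Vx _; have /andP[w0 _] := wx.
  rewrite (gee0_abs Vx).
  have H0 : 0 <= H x by apply: dual_maximal_ge0; exact: ltW.
  rewrite (gee0_abs (mule_ge0 H0 (G20 x))).
  have -> : c%:E * (H x * G2 x * V x) = `|g x| `^ p *
      (c%:E * (maximal A a x * maximal B (fun y => h y * w y) x)).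
    rewrite -(dual_maximalK B h wx) -/(H x) -muleA G2x [RHS]muleCA.
    rewrite -[_ * maximal A a x * w x]muleA [H x * (_ * _)]muleCA.
    by rewrite [H x * (_ * _)]muleCA.
  by apply: lee_wpmul2l; [exact: poweR_ge0|exact: MW].
Qed.

End extrapolation.

Theorem theorem1p14 (R : realType) (n : nat) (n_gt0 : (0 < n)%N)
  (F : set ((euclid R n -> \bar R) * (euclid R n -> \bar R)))
  (hF : extrapolation_family F)
  (Phi A B : R -> R)
  (hPhi : young Phi \/ (forall t : R, (0 <= t)%R -> Phi t = t))
  (hA : young A) (hB : young B)
  (hAB : young_inv_le A B Phi)
  (u v : euclid R n -> \bar R) (hu : weight u) (hv : weight v)
  (Xv XMAv : (euclid R n -> \bar R) -> \bar R)
  (hXv : is_bfs v Xv) (hXMAv : is_bfs (maximal A v) XMAv)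
  (p0 : R) (p0_gt0 : (0 < p0)%R)
  (hext : exists2 C : R, (0 < C)%R &
    forall w0 : euclid R n -> \bar R, weight w0 ->
    forall f g, F (f, g) ->
      lpnorm p0 w0 f <= C%:E * lpnorm p0 (maximal Phi w0) g) :
  let Yv := power_norm p0^-1 Xv in
  let YMAv := power_norm p0^-1 XMAv in
  let up0 := fun x => u x `^ p0 in
  (is_bfs v Yv ->
   (exists2 C : R, (0 < C)%R &
     forall f : euclid R n -> \bar R, measurable_fun setT f ->
       associate v Yv (dual_maximal B v f) <= C%:E * associate v Yv f) ->
   exists2 C : R, (0 < C)%R & forall f g, F (f, g) ->
     Xv (fun x => f x * u x)
       <= C%:E * Xv (fun x => g x * maximal A up0 x `^ p0^-1))
  /\
  (is_bfs v Yv -> is_bfs (maximal A v) YMAv ->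
   (exists2 C : R, (0 < C)%R &
     forall f : euclid R n -> \bar R, measurable_fun setT f ->
       associate (maximal A v) YMAv (dual_maximal B up0 f)
         <= C%:E * associate v Yv f) ->
   exists2 C : R, (0 < C)%R & forall f g, F (f, g) ->
     Xv (fun x => f x * u x) <= C%:E * XMAv (fun x => g x * u x)).
Proof.
move=> Yv YMAv up0.
have gPhi : gauge Phi by case: hPhi => [/young_gauge|/gauge_id].
have gA := young_gauge hA; have gB := young_gauge hB.
have [C0 C00 ext] := hext.
have hup : weight up0 by exact: weight_poweR.
have [mu u0] := hu; have [mv v0] := hv; have [mup _] := hup.
have pV0 : (0 < p0^-1)%R by rewrite invr_gt0.
have pN0 : p0 != 0%R by rewrite gt_eqF.
have measP (k : euclid R n -> \bar R) (r : R) : measurable_fun setT k ->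
    measurable_fun setT (fun x => k x `^ r).
  by move=> mk; exact: (measurableT_comp (measurable_poweR r) mk).
have measA (k : euclid R n -> \bar R) : measurable_fun setT k ->
    measurable_fun setT (fun x => `|k x|).
  by move=> mk; exact: (measurableT_comp (@abse_measurable R setT) mk).
have root (x y : \bar R) (C : R) : (0 < C)%R -> 0 <= x -> 0 <= y ->
    x `^ p0 <= C%:E * y `^ p0 -> x <= (C `^ p0^-1)%:E * y.
  move=> C1 x0 y0 xy.
  have : (x `^ p0) `^ p0^-1 <= (C%:E * y `^ p0) `^ p0^-1.
    apply: (gt0_ler_poweR (ltW pV0) _ _ xy).
      by rewrite in_itv/= poweR_ge0 leey.
    by rewrite in_itv/= leey mule_ge0 ?poweR_ge0// lee_fin ltW.
  rewrite poweRM ?lee_fin ?(ltW C1) ?poweR_ge0// -!poweRrM mulfV//.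
  by rewrite !poweRe1.
have absP (f g : euclid R n -> \bar R) x : 0 <= f x -> 0 < g x < +oo ->
    `|f x * g x| `^ p0 = `|f x| `^ p0 * g x `^ p0.
  move=> f0 /andP[g0 _]; rewrite gee0_abs ?mule_ge0 ?(ltW g0)// gee0_abs//.
  by rewrite poweRM// ltW.
split.
  move=> hYv [K K0 hK].
  have mMA := measurable_maximal A up0.
  have MA0 x : 0 <= maximal A up0 x by exact: maximal_ge0.
  have v0' : {ae leb, forall x, 0 <= v x} by apply: filterS v0 => x /andP[/ltW].
  have [C C1 H] := extrapolation_step gPhi gA gB hAB hv hYv mv v0' hYv hv hup
    p0_gt0 C00 K0 hK.
  exists (C `^ p0^-1)%R; first by rewrite powR_gt0.
  move=> f g Fg; have [mf f0 mg g0] := hF _ _ Fg.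
  have mfu : measurable_fun setT (fun x => f x * u x) by exact: emeasurable_funM.
  have mgM : measurable_fun setT (fun x => g x * maximal A up0 x `^ p0^-1).
    exact: (emeasurable_funM mg (measP _ _ mMA)).
  apply: root; [by []|exact: bfs_ge0 hXv _ mfu|exact: bfs_ge0 hXv _ mgM|].
  have gM0 x : 0 <= g x * maximal A up0 x `^ p0^-1.
    by rewrite mule_ge0 ?poweR_ge0.
  rewrite (bfs_abs hXv mfu) -!power_norm_poweR//.
  apply: (H f g).
  - exact: mf.
  - exact: mg.
  - exact: (measP _ _ (measA _ mfu)).
  - exact: measP.
  - by move=> x; exact: poweR_ge0.
  - by move=> x; exact: poweR_ge0.
  - by apply: filterS u0 => x ux; rewrite (absP _ _ x (f0 x) ux) muleA.
  - apply: aeW => x; rewrite poweRM ?poweR_ge0// -poweRrM mulVf// poweRe1//.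
    by rewrite gee0_abs.
  - by move=> w0 ww0; exact: ext _ ww0 _ _ Fg.
move=> hYv hYMAv [K K0 hK].
have mMA := measurable_maximal A v.
have MA0 : {ae leb, forall x, 0 <= maximal A v x}.
  by apply: aeW => x; exact: maximal_ge0.
have [C C1 H] := extrapolation_step gPhi gA gB hAB hv hYv mMA MA0 hYMAv hup hv
  p0_gt0 C00 K0 hK.
exists (C `^ p0^-1)%R; first by rewrite powR_gt0.
move=> f g Fg; have [mf f0 mg g0] := hF _ _ Fg.
have mfu : measurable_fun setT (fun x => f x * u x) by exact: emeasurable_funM.
have mgu : measurable_fun setT (fun x => g x * u x) by exact: emeasurable_funM.
apply: root; [by []|exact: bfs_ge0 hXv _ mfu|exact: bfs_ge0 hXMAv _ mgu|].
rewrite (bfs_abs hXv mfu) (bfs_abs hXMAv mgu) -!power_norm_poweR//.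
apply: (H f g).
- exact: mf.
- exact: mg.
- exact: (measP _ _ (measA _ mfu)).
- exact: (measP _ _ (measA _ mgu)).
- by move=> x; exact: poweR_ge0.
- by move=> x; exact: poweR_ge0.
- by apply: filterS u0 => x ux; rewrite (absP _ _ x (f0 x) ux) -muleA [X in _ * X]muleC.
- apply: filterS u0 => x ux; rewrite (absP _ _ x (g0 x) ux).
  by rewrite muleAC.
- by move=> w0 ww0; exact: ext _ ww0 _ _ Fg.
Qed.
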